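(* The union $D^2:=\bigcup_{n\ge3}D_{n,n-2}$ has the homotopy type of a countable wedge of $2$-dimensional spheres.
   Context: For an integer $n\ge2$, $\mathcal{G}_n$ is the set of simple undirected graphs on the vertex set $\overline{n}=\{1,2,\ldots,n\}$; each graph is identified with its edge set. A set $D\subseteq\overline{n}$ dominates $\sigma\in\mathcal{G}_n$ if every vertex in $\overline{n}\setminus D$ is adjacent in $\sigma$ to some vertex of $D$. The domination number $\gamma(\sigma)$ is the minimal cardinality of a dominating set of $\sigma$. For $1\le k\le n$, $D_{n,k}$ is the abstract simplicial complex whose $d$-dimensional simplices ($d\ge 0$) are the graphs $\sigma\in\mathcal{G}_n$ (viewed as edge sets) having exactly $d+1$ edges and satisfying $\gamma(\sigma)\ge k$. The complex $D_{n-1,n-3}$ is regarded as a subcomplex of $D_{n,n-2}$ by sending a graph $\sigma$ on $\{1,\ldots,n-1\}$ to the graph on $\{1,\ldots,n\}$ with the same edges and with an additional isolated vertex labelled $n$; the union $D^2$ is the union (limit complex) of the increasing sequence $D_{3,1}\hookrightarrow D_{4,2}\hookrightarrow D_{5,3}\hookrightarrow\cdots$, and its homotopy type is that of its geometric realization. *)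

(* Defs.v *)
From HB Require Import structures.
From mathcomp Require Import all_boot all_order all_algebra.
From mathcomp Require Import finmap.
From mathcomp Require Import all_classical all_reals all_analysis wedge_sigT.
Import Order.TTheory GRing.Theory Num.Theory.
Import numFieldNormedType.Exports.

Set Implicit Arguments.
Unset Strict Implicit.
Unset Printing Implicit Defensive.

Local Open Scope fset_scope.
Local Open Scope classical_set_scope.
Local Open Scope ring_scope.

(* Vertices are labelled by positive integers and a graph is its finite set of
   edges, an edge being a two-element set of vertices.  An edge set does not
   record n, so adding an isolated vertex n.+1 leaves it unchanged: the map
   from D_{n,k} to D_{n+1,k+1} is an inclusion of sets of simplices. *)

Definition vertices (n : nat) : {fset nat} := [fset i in iota 1 n].

Definition graph_on (n : nat) (s : {fset {fset nat}}) : bool :=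
  all (fun e : {fset nat} => (e `<=` vertices n)%fset && (#|` e| == 2)%N) s.

Definition dominates (n : nat) (s : {fset {fset nat}}) (D : {fset nat}) : bool :=
  (D `<=` vertices n)%fset &&
  all (fun x => has (fun y => ([fset x; y]%fset \in s)) D)
      (vertices n `\` D)%fset.

Lemma domination_exists (n : nat) (s : {fset {fset nat}}) :
  exists m, has (fun D : {fset nat} => dominates n s D && (#|` D| == m))
                (fpowerset (vertices n)).
Proof.
exists #|` vertices n|; apply/hasP; exists (vertices n).
  by rewrite fpowersetE fsubset_refl.
by rewrite /dominates fsubset_refl fsetDv eqxx.
Qed.

Definition domination_number (n : nat) (s : {fset {fset nat}}) : nat :=
  ex_minn (domination_exists n s).

Record simplicial_complex (V : choiceType) := SimplicialComplex {
  simplices :> set {fset V};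
  simplices_neq0 : forall s, simplices s -> s != fset0;
  simplices_sub : forall s t, simplices s -> (t `<=` s)%fset -> t != fset0 ->
    simplices t
}.

Lemma graph_on_sub (n : nat) (s t : {fset {fset nat}}) :
  (t `<=` s)%fset -> graph_on n s -> graph_on n t.
Proof. by move=> /fsubsetP ts /allP gs; apply/allP => e /ts /gs. Qed.

Lemma dominates_sub (n : nat) (s t : {fset {fset nat}}) (D : {fset nat}) :
  (t `<=` s)%fset -> dominates n t D -> dominates n s D.
Proof.
move=> /fsubsetP ts /andP[Dn /allP tD]; rewrite /dominates Dn /=.
apply/allP => x /tD /hasP[y yD xy]; apply/hasP; exists y => //; exact: ts.
Qed.

Lemma domination_number_sub (n : nat) (s t : {fset {fset nat}}) :
  (t `<=` s)%fset -> (domination_number n s <= domination_number n t)%N.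
Proof.
move=> ts; rewrite /domination_number.
case: (ex_minnP (domination_exists n t)) => m /hasP[D Dn /andP[tD Dm]] _.
case: ex_minnP => k _; apply; apply/hasP; exists D => //.
by rewrite Dm (dominates_sub ts tD).
Qed.

Section domination_complex.
Variables n k : nat.

Definition domination_simplices : set {fset {fset nat}} :=
  [set s | [/\ graph_on n s, s != fset0 & (k <= domination_number n s)%N]].

Lemma domination_simplices_neq0 s : domination_simplices s -> s != fset0.
Proof. by case. Qed.

Lemma domination_simplices_sub s t :
  domination_simplices s -> (t `<=` s)%fset -> t != fset0 ->
  domination_simplices t.
Proof.
move=> [gs _ ks] ts t0; split => //; first exact: graph_on_sub gs.
exact: leq_trans ks (domination_number_sub n ts).
Qed.

Definition domination_complex : simplicial_complex {fset nat} :=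
  SimplicialComplex domination_simplices_neq0 domination_simplices_sub.

End domination_complex.

Lemma mem_vertices (n i : nat) : (i \in vertices n) = (0 < i <= n)%N.
Proof. by rewrite !inE /= mem_iota add1n ltnS. Qed.

Lemma domination_numberS (n : nat) (s : {fset {fset nat}}) : graph_on n s ->
  (domination_number n s < domination_number n.+1 s)%N.
Proof.
move=> /allP gs; rewrite {2}/domination_number.
case: ex_minnP => m /hasP[D _ /andP[/andP[/fsubsetP Dn /allP sD] /eqP Dm]] _.
have edge x y : [fset x; y]%fset \in s -> (x <= n)%N /\ (y <= n)%N.
  move=> /gs /andP[/fsubsetP xyn _].
  have := xyn x (fset21 _ _); have := xyn y (fset22 _ _).
  by rewrite !mem_vertices => /andP[_ ->] /andP[_ ->].
have nD : n.+1 \in D.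
  apply/negPn/negP => nD.
  have /hasP[y _ /edge[]] : has (fun y => [fset n.+1; y]%fset \in s) D.
    by apply: sD; rewrite in_fsetD nD mem_vertices leqnn.
  by rewrite ltnn.
have D'n : (D `\ n.+1 `<=` vertices n)%fset.
  apply/fsubsetP => x; rewrite in_fsetD1 => /andP[xn /Dn].
  by rewrite !mem_vertices (leq_eqVlt x) (negbTE xn) ltnS.
have D's : dominates n s (D `\ n.+1)%fset.
  rewrite /dominates D'n; apply/allP => x.
  rewrite in_fsetD in_fsetD1 mem_vertices negb_and negbK => /andP[xD /andP[x0 xn]].
  have /hasP[y yD xys] : has (fun y => [fset x; y]%fset \in s) D.
    apply: sD; rewrite in_fsetD mem_vertices x0 (leqW xn) !andbT.
    by case/orP: xD => [/eqP xE|]; first by rewrite xE ltnn in xn.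
  apply/hasP; exists y => //; rewrite in_fsetD1 yD andbT.
  by apply/eqP => yE; have [_] := edge _ _ xys; rewrite yE ltnn.
move: (cardfsD1 n.+1 D); rewrite nD Dm add1n => ->; rewrite ltnS.
rewrite /domination_number; case: ex_minnP => k _; apply.
by apply/hasP; exists (D `\ n.+1)%fset; rewrite ?fpowersetE ?D'n ?D's ?eqxx.
Qed.

Lemma domination_complexS (n k : nat) :
  simplices (domination_complex n k) `<=`
  simplices (domination_complex n.+1 k.+1).
Proof.
move=> s [gs s0 ks]; split => //; last exact: leq_ltn_trans (domination_numberS gs).
apply/allP => e /(allP gs) /andP[/fsubsetP en ->]; rewrite andbT.
apply/fsubsetP => x /en; rewrite !mem_vertices => /andP[-> /=]; exact: leqW.
Qed.

Section complex_union.
Variables (I : Type) (V : choiceType).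
Variables (P : set I) (K : I -> simplicial_complex V).

Definition union_simplices : set {fset V} := \bigcup_(i in P) simplices (K i).

Lemma union_simplices_neq0 s : union_simplices s -> s != fset0.
Proof. by case=> i _; exact: simplices_neq0. Qed.

Lemma union_simplices_sub s t :
  union_simplices s -> (t `<=` s)%fset -> t != fset0 -> union_simplices t.
Proof. by case=> i Pi Ks ts t0; exists i => //; exact: simplices_sub Ks ts t0. Qed.

Definition complex_union : simplicial_complex V :=
  SimplicialComplex union_simplices_neq0 union_simplices_sub.

End complex_union.

Definition D2 : simplicial_complex {fset nat} :=
  complex_union [set n | (3 <= n)%N]
    (fun n => domination_complex n (n - 2)).

Section realization.
Variables (R : realType) (V : choiceType).

(* The closed simplex spanned by s, in barycentric coordinates.  The pointwise
   topology on functions induces on it the Euclidean topology. *)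
Definition closed_simplex (s : {fset V}) : set {ptws V -> R} :=
  [set x | [/\ forall v, 0 <= x v, forall v, v \notin s -> x v = 0
             & \sum_(v <- s) x v = 1]].

Variable K : simplicial_complex V.

Definition realization_points : set {ptws V -> R} :=
  \bigcup_(s in simplices K) closed_simplex s.

(* A record rather than a subtype: a subtype would come with the subspace
   topology, which is coarser than the weak topology when K is not locally
   finite. *)
Record realization : Type := Realization {
  realization_coord :> {ptws V -> R};
  realization_coordP : realization_points realization_coord
}.

HB.instance Definition _ := gen_eqMixin realization.
HB.instance Definition _ := gen_choiceMixin realization.

(* U is open iff its trace on every closed simplex is open in that simplex. *)
Definition realization_open (U : set realization) : Prop :=
  forall s, simplices K s ->
    exists2 W : set {ptws V -> R}, open W &
      forall x : realization, closed_simplex s (realization_coord x) ->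
        (U x <-> W (realization_coord x)).

Lemma realization_openT : realization_open [set: realization].
Proof. by move=> s _; exists setT => //; exact: openT. Qed.

Lemma realization_openI : setI_closed realization_open.
Proof.
move=> A B Ao Bo s Ks; have [W oW AW] := Ao s Ks; have [Z oZ BZ] := Bo s Ks.
exists (W `&` Z); first exact: openI.
by move=> x sx; have := AW x sx; have := BZ x sx; rewrite /setI /=; tauto.
Qed.

Lemma realization_open_bigcup (I : Type) (f : I -> set realization) :
  (forall i, realization_open (f i)) -> realization_open (\bigcup_i f i).
Proof.
move=> fo s Ks.
pose P i W := open W /\ forall x : realization,
  closed_simplex s (realization_coord x) ->
  (f i x <-> W (realization_coord x)).
have PO i : P i (get (P i)).
  by apply: (@getPex _ (P i)); have [W oW fW] := fo i s Ks; exists W.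
exists (\bigcup_i get (P i)); first by apply: bigcup_open => i _; case: (PO i).
move=> x sx; split=> -[i _ h]; exists i => //; have [_ /(_ x sx)] := PO i; tauto.
Qed.

HB.instance Definition _ := isOpenTopological.Build realization
  realization_openT realization_openI realization_open_bigcup.

End realization.

Section sphere.
Variables (R : realType) (d : nat).

Definition sphere_set : set 'rV[R]_d.+1 :=
  [set x : 'rV[R]_d.+1 | \sum_(i < d.+1) x ord0 i ^+ 2 = 1].

Definition sphere : topologicalType := set_type sphere_set.

Lemma sphere_base_subproof : sphere_set (delta_mx ord0 ord0).
Proof.
rewrite /sphere_set /= (bigD1 ord0) //= mxE !eqxx expr1n big1 ?addr0 //.
by move=> i i0; rewrite mxE (negbTE i0) andbF expr0n.
Qed.

Definition sphere_base : sphere := SigSub (mem_set sphere_base_subproof).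

End sphere.

(* One copy of the d-sphere for each natural number, with the quotient topology
   of the disjoint union. *)
Definition countable_sphere_wedge (R : realType) (d : nat) : topologicalType :=
  wedge (fun _ : nat => sphere_base R d).

Section homotopy.
Variable R : realType.

Definition homotopic (X Y : topologicalType) (f g : X -> Y) : Prop :=
  exists H : X * R -> Y,
    [/\ {within [set: X] `*` `[0, 1]%classic, continuous H},
        forall x, H (x, 0) = f x & forall x, H (x, 1) = g x].

Definition homotopy_equivalent (X Y : topologicalType) : Prop :=
  exists (f : X -> Y) (g : Y -> X),
    [/\ continuous f, continuous g,
        homotopic (g \o f) idfun & homotopic (f \o g) idfun].

End homotopy.

(* Main.v *)
Require Import Defs.
From HB Require Import structures.
From mathcomp Require Import all_boot all_order all_algebra.
From mathcomp Require Import finmap.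
From mathcomp Require Import all_classical all_reals all_analysis wedge_sigT.
From mathcomp Require Import zify ring lra.
Import Order.TTheory GRing.Theory Num.Theory.
Import numFieldNormedType.Exports.

Set Implicit Arguments.
Unset Strict Implicit.
Unset Printing Implicit Defensive.

Local Open Scope fset_scope.
Local Open Scope classical_set_scope.
Local Open Scope ring_scope.

(* A graph is a simplex of D2 iff it contains no star forest with three edges,
   so the simplices are all sets of at most two edges, the triangles, the paths
   with three edges and the 4-cycles. Each tetrahedron, a 4-cycle, has only free
   2-faces and is collapsed from one of them; a 2-dimensional complex remains.
   It contains a contractible subcomplex L with the complete 1-skeleton, built
   from a point by elementary expansions: when the vertex iN is added, a spanning
   tree of its link among the earlier vertices is coned off. Contracting L
   stage by stage, in infinitely many steps, and extending the contraction to the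
   remaining triangles, one finds that the complex is equivalent to its quotient
   by L, a wedge of 2-spheres, one for each triangle outside L. *)

(** * Homotopies and continuity on realizations *)

(** Two obstacles shape the proof: infinitely many stages must fit into one homotopy, and continuity
    must hold in the weak topology, which coordinates describe only on finite subcomplexes. The
    stages are undone in reverse order, so there is no first one, and their time slots accumulate at
    0. A given simplex is moved by finitely many of them only, which gives continuity simplex by
    simplex. That this suffices for a homotopy rests on the local compactness of the time line;
    times range over all of [R] to avoid subspace topologies.

    The quotient by L is never formed. An explicit wrapping of triangles around spheres maps the
    complex straight onto the wedge; it is a quotient map whose only nontrivial fibre is L, and the
    contraction descends along it. The extension of the contraction to a triangle is a formula as
    well: a growing collar is pushed to the boundary and follows the flow there with a delay.

    That the wedge has infinitely many summands is shown by an explicit family of paths outside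
    L. *)

Lemma continuous_funcomp (X Y Z : topologicalType) (g : Y -> Z) (f : X -> Y) :
  continuous g -> continuous f -> continuous (fun x => g (f x)).
Proof. by move=> cg cf x; apply: (continuous_comp (cf x)); exact: cg. Qed.

Lemma continuous_pair2 (X Y Z : topologicalType) (f : X -> Y) (g : X -> Z) :
  continuous f -> continuous g -> continuous (fun x => (f x, g x)).
Proof. by move=> cf cg x; apply: cvg_pair; [exact: cf|exact: cg]. Qed.

Lemma continuous_fst (X Y : topologicalType) : continuous (fst : X * Y -> X).
Proof. by move=> p; exact: cvg_fst. Qed.

Lemma continuous_snd (X Y : topologicalType) : continuous (snd : X * Y -> Y).
Proof. by move=> p; exact: cvg_snd. Qed.

(** * Homotopies over all real times *)

Section global_homotopy.
Variable R : realType.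

Definition global_homotopic (X Y : topologicalType) (f g : X -> Y) : Prop :=
  exists H : X * R -> Y,
    [/\ continuous H, forall x, H (x, 0) = f x & forall x, H (x, 1) = g x].

Lemma global_homotopicW (X Y : topologicalType) (f g : X -> Y) :
  global_homotopic f g -> homotopic R f g.
Proof.
by move=> [H [cH H0 H1]]; exists H; split => //; exact: continuous_subspaceT.
Qed.

Lemma global_homotopic_sym (X Y : topologicalType) (f g : X -> Y) :
  global_homotopic f g -> global_homotopic g f.
Proof.
move=> [H [cH H0 H1]]; exists (fun p => H (p.1, 1 - p.2)); split.
- apply: continuous_funcomp cH _; apply: continuous_pair2; first exact: continuous_fst.
  by move=> p; apply: cvgB; [exact: cvg_cst|exact: cvg_snd].
- by move=> x /=; rewrite subr0.
- by move=> x /=; rewrite subrr.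
Qed.

Lemma global_homotopic_trans (X Y : topologicalType) (f g h : X -> Y) :
  global_homotopic f g -> global_homotopic g h -> global_homotopic f h.
Proof.
move=> [H [cH H0 H1]] [G [cG G0 G1]].
pose a (p : X * R) := H (p.1, 2 * p.2).
pose b (p : X * R) := G (p.1, 2 * p.2 - 1).
have ca : continuous a.
  apply: continuous_funcomp cH _; apply: continuous_pair2; first exact: continuous_fst.
  by move=> p; apply: cvgM; [exact: cvg_cst|exact: cvg_snd].
have cb : continuous b.
  apply: continuous_funcomp cG _; apply: continuous_pair2; first exact: continuous_fst.
  move=> p; apply: cvgB; last exact: cvg_cst.
  by apply: cvgM; [exact: cvg_cst|exact: cvg_snd].
pose A : set (X * R) := [set p | p.2 <= 2^-1].
pose B : set (X * R) := [set p | 2^-1 <= p.2].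
pose K p := if p.2 <= 2^-1 then a p else b p.
have cs : continuous (snd : X * R -> R) by move=> p; exact: cvg_snd.
have clA : closed A by apply: (preimage_closed _ (@closed_le _ 2^-1)) => p _; exact: cs.
have clB : closed B by apply: (preimage_closed _ (@closed_ge _ 2^-1)) => p _; exact: cs.
have AB : A `|` B = setT.
  by apply/seteqP; split => // p _; rewrite /A /B /=; apply/orP; exact: le_total.
have cA : {within A, continuous K}.
  apply: (@subspace_eq_continuous _ A _ a).
    by move=> p; rewrite inE /A /K /= => hp; rewrite /from_subspace hp.
  exact: (continuous_subspaceT ca).
have cB : {within B, continuous K}.
  apply: (@subspace_eq_continuous _ B _ b).
    move=> [x t]; rewrite inE /B /K /from_subspace /= => ht; case: ifPn => // th.
    have -> : t = 2^-1 by apply/eqP; rewrite eq_le ht th.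
    by rewrite /a /b /= mulfV ?pnatr_eq0 // subrr G0 H1.
  exact: (continuous_subspaceT cb).
exists K; split.
- have := withinU_continuous clA clB cA cB.
  by rewrite AB => cK; apply/continuous_subspace_setT; exact: cK.
- by move=> x; rewrite /K /= invr_ge0 ler0n /a /= mulr0 H0.
- move=> x; rewrite /K /= ifF; first by rewrite /b /= mulr1 -(G1 x); congr (G (_, _)); lra.
  by apply/negbTE; rewrite -ltNge; lra.
Qed.

Lemma global_homotopic_comp (X Y Z W : topologicalType) (f g : X -> Y)
    (u : W -> X) (v : Y -> Z) : continuous u -> continuous v ->
  global_homotopic f g -> global_homotopic (v \o f \o u) (v \o g \o u).
Proof.
move=> cu cv [H [cH H0 H1]]; exists (fun p => v (H (u p.1, p.2))); split.
- apply: continuous_funcomp cv _; apply: continuous_funcomp cH _.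
  apply: continuous_pair2; last exact: continuous_snd.
  by apply: continuous_funcomp cu _; exact: continuous_fst.
- by move=> x /=; rewrite H0.
- by move=> x /=; rewrite H1.
Qed.

End global_homotopy.

Definition strong_equivalent (R : realType) (X Y : topologicalType) : Prop :=
  exists (f : X -> Y) (g : Y -> X),
    [/\ continuous f, continuous g,
        global_homotopic R (g \o f) idfun & global_homotopic R (f \o g) idfun].

Lemma strong_equivalentW (R : realType) (X Y : topologicalType) :
  strong_equivalent R X Y -> homotopy_equivalent R X Y.
Proof.
by move=> [f [g [cf cg gf fg]]]; exists f, g; split => //; exact: global_homotopicW.
Qed.

Lemma strong_equivalent_trans (R : realType) (X Y Z : topologicalType) :
  strong_equivalent R X Y -> strong_equivalent R Y Z -> strong_equivalent R X Z.
Proof.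
move=> [f [g [cf cg gf fg]]] [f' [g' [cf' cg' gf' fg']]].
exists (f' \o f), (g \o g'); split.
- exact: continuous_funcomp.
- exact: continuous_funcomp.
- exact: global_homotopic_trans (global_homotopic_comp cf cg gf') gf.
- exact: global_homotopic_trans (global_homotopic_comp cg' cf' fg) fg'.
Qed.

(** * Final topologies and products with the real line *)

Section currying.
Import ArrowAsCompactOpen.

(* [X * R] carries the final topology of the maps [j i * id] when [X] carries
   that of the maps [j i], because [R] is locally compact. *)
Lemma continuous_final_prod (R : realType) (I : Type) (Z : I -> topologicalType)
    (X Y : topologicalType) (j : forall i, Z i -> X) (f : X * R -> Y) :
  (forall U : set X, (forall i, open (j i @^-1` U)) -> open U) ->
  (forall x, exists i z, j i z = x) ->
  (forall i, continuous (fun p : Z i * R => f (j i p.1, p.2))) ->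
  continuous f.
Proof.
move=> final surj cf.
(* The exponential law moves the time variable into a function space, leaving a map on [X] alone to
   which the final topology applies. *)
have cj i := continuous_curry (cf i).
have -> : f = uncurry (curry f) by apply/funext => -[].
apply: continuous_uncurry.
- exact: locally_compactR.
- exact: Rhausdorff.
- apply/continuousP => U oU; apply: final => i.
  by have [/continuousP /(_ U oU)] := cj i.
- by move=> x; have [i [z <-]] := surj x; have [_] := cj i; apply.
Qed.

End currying.

Lemma continuous_ptws (T : topologicalType) (V : choiceType) (U : topologicalType)
    (f : T -> {ptws V -> U}) :
  (forall v, continuous (fun x => f x v)) -> continuous f.
Proof.
move=> cf x; apply/cvg_sup => v A.
move=> [B [[C oC <-] Cv] BA]; apply: (filterS BA).
by apply: (cf v x); exact: open_nbhs_nbhs.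
Qed.

Lemma continuous_eval (V : choiceType) (U : topologicalType) (v : V) :
  continuous (fun x : {ptws V -> U} => x v).
Proof. exact: (@proj_continuous V (fun=> U) v). Qed.

Lemma continuous_sum (R : realType) (T : topologicalType) (I : Type) (r : seq I)
    (P : pred I) (F : I -> T -> R) :
  (forall i, continuous (F i)) -> continuous (fun x => \sum_(i <- r | P i) F i x).
Proof.
move=> cF; apply: continuous_big => // x.
by apply: cvgD; [exact: cvg_fst|exact: cvg_snd].
Qed.

(** * The weak topology of a realization *)

Section realization_topology.
Variables (R : realType) (V : choiceType) (K : simplicial_complex V).

Lemma closed_simplex_closed (s : {fset V}) : closed (@closed_simplex R V s).
Proof.
have -> : @closed_simplex R V s =
    (\bigcap_v (fun x : {ptws V -> R} => x v) @^-1` [set r | 0 <= r]) `&`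
    (\bigcap_(v in [set v | v \notin s]) (fun x : {ptws V -> R} => x v) @^-1` [set 0]) `&`
    (fun x : {ptws V -> R} => \sum_(v <- s) x v) @^-1` [set 1].
  apply/seteqP; split => x.
    by move=> [x0 xs x1]; split=> //; split=> v; [move=> _; exact: x0|exact: xs].
  move=> [[x0 xs] x1]; split => //.
  by move=> v; exact: (x0 v I).
apply: closedI; first apply: closedI.
- apply: closed_bigI => v _; apply: (preimage_closed _ (@closed_ge _ 0)) => x _.
  exact: continuous_eval.
- apply: closed_bigI => v _; apply: (preimage_closed _ (@closed_eq _ 0)) => x _.
  exact: continuous_eval.
- apply: (preimage_closed _ (@closed_eq _ 1)) => x _.
  by apply: continuous_sum => v; exact: continuous_eval.
Qed.

Lemma closed_simplexP (s : {fset V}) (Ks : simplices K s) (x : @closed_simplex R V s) :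
  realization_points K (set_val x).
Proof. by exists s => //; exact: set_valP. Qed.

Definition simplex_point (s : {fset V}) (Ks : simplices K s) (x : @closed_simplex R V s) :
  realization R K := Realization (closed_simplexP Ks x).

Lemma realization_inj (x y : realization R K) :
  (forall v, realization_coord x v = realization_coord y v) -> x = y.
Proof.
case: x y => [x px] [y py] /= xy; have E : x = y by exact/funext.
by rewrite -E in py *; congr Realization; exact: Prop_irrelevance.
Qed.

(** Recasts the weak topology as the final topology of the maps [simplex_point], the form that
    [continuous_final_prod] needs. *)
Lemma realization_openP (U : set (realization R K)) :
  (forall s (Ks : simplices K s), open (simplex_point Ks @^-1` U)) -> open U.
Proof.
move=> oU; suff: realization_open U by [].
move=> s Ks; have [W oW WU] := oU s Ks; exists W => // x sx.
have := congr1 (fun A : set _ => A (exist _ (realization_coord x) (mem_set sx))) WU.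
rewrite /preimage /=.
rewrite (_ : simplex_point _ _ = x); last exact: realization_inj.
by rewrite set_valE /= => ->.
Qed.

Lemma realization_continuous_prod (Y : topologicalType)
    (f : realization R K * R -> Y) :
  (forall s (Ks : simplices K s),
    continuous (fun p : @closed_simplex R V s * R => f (simplex_point Ks p.1, p.2))) ->
  continuous f.
Proof.
move=> cf.
apply: (@continuous_final_prod R {s | simplices K s}
  (fun s => @closed_simplex R V (proj1_sig s)) _ _
  (fun s => simplex_point (proj2_sig s))).
- by move=> U oU; apply: realization_openP => s Ks; exact: (oU (exist _ s Ks)).
- move=> x; have [s Ks sx] := realization_coordP x.
  exists (exist _ s Ks), (SigSub (mem_set sx)); exact: realization_inj.
- by move=> [s Ks]; exact: cf.
Qed.

Lemma realization_continuous (Y : topologicalType) (f : realization R K -> Y) :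
  (forall s (Ks : simplices K s), continuous (f \o simplex_point Ks)) -> continuous f.
Proof.
move=> cf; apply/continuousP => U oU; apply: realization_openP => s Ks.
by have /continuousP /(_ U oU) := cf s Ks.
Qed.

(* On a finite subcomplex the weak topology is the topology of coordinates. *)
Lemma continuous_to_realization (T : topologicalType) (F : seq {fset V})
    (f : T -> realization R K) :
  (forall s, s \in F -> simplices K s) ->
  (forall x, exists2 s, s \in F & closed_simplex s (realization_coord (f x))) ->
  continuous (fun x => realization_coord (f x)) -> continuous f.
Proof.
move=> FK fF cf; apply/continuousP => U oU.
have [W WU] : exists W : {fset V} -> set {ptws V -> R}, forall s, s \in F ->
    open (W s) /\ forall x : realization R K, closed_simplex s (realization_coord x) ->
     (U x <-> W s (realization_coord x)).
  have h s : exists Ws : set {ptws V -> R}, s \in F ->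
    open Ws /\ forall x : realization R K, closed_simplex s (realization_coord x) ->
     (U x <-> Ws (realization_coord x)).
    case: (boolP (s \in F)) => sF; last by exists setT.
    by have [Ws oWs UWs] := oU s (FK s sF); exists Ws.
  by have [W hW] := choice h; exists W.
(* A set [W s] says nothing off its own simplex, so these sets are not combined directly. The points
   of the finite subcomplex outside [U] form the closed set [C]. *)
pose C := \big[setU/set0]_(s <- F) (closed_simplex s `&` ~` W s).
have cC : closed C.
  rewrite /C big_seq; apply: big_ind => //; first exact: closed0.
    by move=> A B; exact: closedU.
  move=> s sF; apply: closedI; first exact: closed_simplex_closed.
  by apply: open_closedC; have [] := WU s sF.
have -> : f @^-1` U = (fun x => realization_coord (f x)) @^-1` (~` C).
  apply/seteqP; split=> x /=.
    move=> Ufx; rewrite /C -bigcup_seq => -[s sF [sx nW]].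
    by have [_ /(_ _ sx) [/(_ Ufx)]] := WU s sF.
  rewrite /C -bigcup_seq => nC; have [s sF sx] := fF x.
  have [_ /(_ _ sx) [_]] := WU s sF; apply.
  by apply: contrapT => nW; apply: nC; exists s.
by move/continuousP: cf; apply; exact: closed_openC.
Qed.

End realization_topology.

(** The continuity criterion used throughout: on each closed simplex the map is a formula in
    coordinates with values in finitely many simplices, where the weak topology is that of
    coordinates. *)
Lemma realization_homotopy (R : realType) (V W : choiceType) (K : simplicial_complex V)
    (L : simplicial_complex W) (f : realization R K * R -> realization R L) :
  (forall s, simplices K s ->
   exists (G : {ptws V -> R} * R -> {ptws W -> R}) (F : seq {fset W}),
    [/\ continuous G, forall t, t \in F -> simplices L t &
     forall (x : realization R K) t, closed_simplex s (realization_coord x) ->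
       realization_coord (f (x, t)) = G (realization_coord x, t) /\
       exists2 u, u \in F & closed_simplex u (realization_coord (f (x, t)))]) ->
  continuous f.
Proof.
move=> hf; apply: realization_continuous_prod => s Ks.
have [G [F [cG FL GF]]] := hf s Ks.
have sP (x : @closed_simplex R V s) : closed_simplex s (realization_coord (simplex_point Ks x)).
  exact: set_valP.
apply: (@continuous_to_realization _ _ _ _ F) => //.
  by move=> [x t]; have [_] := GF _ t (sP x).
rewrite (_ : (fun _ => _) = fun p : @closed_simplex R V s * R => G (set_val p.1, p.2)).
  apply: continuous_funcomp cG _; apply: continuous_pair2; last exact: continuous_snd.
  apply: (@continuous_funcomp _ _ _ set_val fst); last exact: continuous_fst.
  exact: initial_continuous.
by apply/funext => -[x t]; have [] := GF _ t (sP x).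
Qed.

Lemma realization_map (R : realType) (V W : choiceType) (K : simplicial_complex V)
    (L : simplicial_complex W) (f : realization R K -> realization R L) :
  (forall s, simplices K s -> exists (G : {ptws V -> R} -> {ptws W -> R}) (F : seq {fset W}),
    [/\ continuous G, forall t, t \in F -> simplices L t &
     forall (x : realization R K), closed_simplex s (realization_coord x) ->
       realization_coord (f x) = G (realization_coord x) /\
       exists2 u, u \in F & closed_simplex u (realization_coord (f x))]) ->
  continuous f.
Proof.
move=> hf.
have cF : continuous (fun p : realization R K * R => f p.1).
  apply: realization_homotopy => s Ks; have [G [F [cG FL GF]]] := hf s Ks.
  exists (fun p => G p.1), F; split => //.
    by apply: continuous_funcomp cG _; exact: continuous_fst.
  by move=> x t; exact: GF.
have := @continuous_funcomp _ _ _ _ (fun x => (x, 0 : R)) cF; apply.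
by apply: continuous_pair2; [move=> x; exact: cvg_id|exact: cst_continuous].
Qed.

Lemma continuous_maxr (R : realType) (T : topologicalType) (f g : T -> R) :
  continuous f -> continuous g -> continuous (fun x => Num.max (f x) (g x)).
Proof. exact: max_fun_continuous. Qed.

Lemma continuous_minr (R : realType) (T : topologicalType) (f g : T -> R) :
  continuous f -> continuous g -> continuous (fun x => Num.min (f x) (g x)).
Proof. exact: min_fun_continuous. Qed.

(** Freezes a homotopy outside the unit interval, so that it is defined for all real times. *)
Definition clamp (R : realType) (t : R) : R := Num.max 0 (Num.min t 1).

Section clamp.
Variable R : realType.

Lemma clamp_ge0 (t : R) : 0 <= clamp t.
Proof. by rewrite /clamp le_max lexx. Qed.

Lemma clamp_le1 (t : R) : clamp t <= 1.
Proof. by rewrite /clamp ge_max ler01 ge_min lexx orbT. Qed.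

Lemma clamp0 (t : R) : t <= 0 -> clamp t = 0.
Proof. by move=> t0; rewrite /clamp; apply/max_idPl; rewrite ge_min t0. Qed.

Lemma clamp1 (t : R) : 1 <= t -> clamp t = 1.
Proof. by move=> t1; rewrite /clamp (min_idPr t1); apply/max_idPr. Qed.

Lemma continuous_clamp (T : topologicalType) (f : T -> R) :
  continuous f -> continuous (fun x => clamp (f x)).
Proof.
move=> cf; apply: continuous_maxr; first exact: cst_continuous.
by apply: continuous_minr => //; exact: cst_continuous.
Qed.

End clamp.

Lemma sum_fsetD1 (R : realType) (V : choiceType) (s : {fset V}) (f : V -> R) v :
  v \in s -> \sum_(w <- s) f w = f v + \sum_(w <- (s `\ v)%fset) f w.
Proof. exact: big_fsetD1. Qed.

Lemma sum_fset_incl (R : realType) (V : choiceType) (s t : {fset V}) (f : V -> R) :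
  (s `<=` t)%fset -> (forall v, v \in t -> v \notin s -> f v = 0) ->
  \sum_(w <- s) f w = \sum_(w <- t) f w.
Proof. by move=> st f0; apply: big_fset_incl st f0. Qed.

Lemma continuous_mul (R : realType) (T : topologicalType) (f g : T -> R) :
  continuous f -> continuous g -> continuous (fun x => f x * g x).
Proof. by move=> cf cg x; apply: cvgM; [exact: cf|exact: cg]. Qed.

Lemma continuous_at_div (R : realType) (T : topologicalType) (f g : T -> R) x :
  continuous f -> continuous g -> g x != 0 ->
  {for x, continuous (fun y => f y / g y)}.
Proof. by move=> cf cg gx; apply: cvgM; [exact: cf|apply: cvgV => //; exact: cg]. Qed.

Lemma continuous_sub (R : realType) (T : topologicalType) (f g : T -> R) :
  continuous f -> continuous g -> continuous (fun x => f x - g x).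
Proof. by move=> cf cg x; apply: cvgB; [exact: cf|exact: cg]. Qed.

Lemma continuous_add (R : realType) (T : topologicalType) (f g : T -> R) :
  continuous f -> continuous g -> continuous (fun x => f x + g x).
Proof. by move=> cf cg x; apply: cvgD; [exact: cf|exact: cg]. Qed.

(** * The collapse of one simplex from a free face *)

Section push.
Variables (R : realType) (V : choiceType).
Implicit Types (s sg : {fset V}) (x : {ptws V -> R}).

(** The default value 1 is harmless for nonempty [sg], because coordinates in a closed simplex are
    at most 1; see [leastP]. *)
Definition least sg x : R := \big[Num.min/1]_(v <- sg) x v.

(* Moves mass from all vertices of [sg] evenly to [a], until (for [c = 1]) one
   of them is used up: the deformation of an elementary collapse of the simplex
   [a |` sg] from its free face [sg]. *)
Definition push_dir sg (a v : V) : R := #|` sg|%:R * (v == a)%:R - (v \in sg)%:R.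

Definition push sg a (c : R) x : {ptws V -> R} :=
  fun v => x v + c * least sg x * push_dir sg a v.

Lemma closed_simplex_le1 s x v : closed_simplex s x -> x v <= 1.
Proof.
move=> [x0 xs x1]; case: (boolP (v \in s)) => vs; last by rewrite xs.
by rewrite -x1 (sum_fsetD1 x vs) lerDl sumr_ge0.
Qed.

Lemma closed_simplexS s t x : (s `<=` t)%fset -> closed_simplex s x ->
  closed_simplex t x.
Proof.
move=> /fsubsetP st [x0 xs x1]; split => //.
  by move=> v vt; apply: xs; apply: contra vt; exact: st.
rewrite -x1; symmetry; apply: sum_fset_incl => //; first exact/fsubsetP.
by move=> v vt vs; exact: xs.
Qed.

Lemma closed_simplex_sub s t x : closed_simplex t x ->
  (forall v, v \in t -> v \notin s -> x v = 0) -> closed_simplex (s `&` t)%fset x.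
Proof.
move=> [x0 xt x1] h; split => //.
  move=> v; rewrite in_fsetI negb_and => /orP[vs|]; last exact: xt.
  by case: (boolP (v \in t)) => vt; [exact: h|exact: xt].
rewrite -x1; apply: sum_fset_incl (fsubsetIr _ _) _.
by move=> v vt; rewrite in_fsetI vt andbT => vs; exact: h.
Qed.

Lemma least_le sg x v : v \in sg -> least sg x <= x v.
Proof.
move=> vs; have {vs} : v \in enum_fset sg by [].
rewrite /least; elim: (enum_fset sg) => // w l IH; rewrite inE big_cons ge_min.
by case/orP => [/eqP ->|/IH ->]; rewrite ?lexx ?orbT.
Qed.

Lemma least_ge0 sg x : (forall v, 0 <= x v) -> 0 <= least sg x.
Proof.
move=> x0; rewrite /least; apply: (big_ind (fun r : R => 0 <= r)) => //.
by move=> a b a0 b0; rewrite le_min a0.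
Qed.

Lemma least_eq0 sg x v : (forall v, 0 <= x v) -> v \in sg -> x v = 0 ->
  least sg x = 0.
Proof.
move=> x0 vs xv; apply/eqP; rewrite eq_le least_ge0 // andbT -xv; exact: least_le.
Qed.

Lemma leastP sg x : sg != fset0 -> (forall v, x v <= 1) ->
  exists2 v, v \in sg & least sg x = x v.
Proof.
move=> /fset0Pn[v0 v0s] x1.
have : least sg x = 1 \/ exists2 v, v \in sg & least sg x = x v.
  rewrite /least big_seq; apply: (big_ind (fun r => r = 1 \/ exists2 v, v \in sg & r = x v)).
  - by left.
  - by move=> a b ha hb; rewrite /Num.min; case: ifP.
  - by move=> v vs; right; exists v.
case=> // l1; exists v0 => //; apply/eqP; rewrite eq_le least_le //=.
by rewrite l1.
Qed.

Lemma push0 sg a x : push sg a 0 x = x.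
Proof. by apply/funext => v; rewrite /push mul0r mul0r addr0. Qed.

(** Faces that miss a vertex of [sg] are fixed pointwise, so the pushes of different simplices fit
    together. *)
Lemma push_id sg a c x : least sg x = 0 -> push sg a c x = x.
Proof. by move=> l0; apply/funext => v; rewrite /push l0 mulr0 mul0r addr0. Qed.

Lemma sum_push_dir sg a : a \notin sg -> \sum_(v <- (a |` sg)%fset) push_dir sg a v = 0.
Proof.
move=> asg; rewrite big_fsetU1 //= /push_dir eqxx (negbTE asg) mulr1 subr0.
rewrite big_seq (eq_bigr (fun=> -1)) -?big_seq.
  by rewrite big_const_seq count_predT iter_addr_0 mulNrn addrC addNr.
move=> v vs; rewrite vs; case: eqP => [va|_]; last by rewrite mulr0 sub0r.
by move: asg; rewrite -va vs.
Qed.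

Lemma push_simplex sg a c x : a \notin sg -> 0 <= c -> c <= 1 ->
  closed_simplex (a |` sg)%fset x -> closed_simplex (a |` sg)%fset (push sg a c x).
Proof.
move=> asg c0 c1 sx; have [x0 xs x1] := sx; split.
- move=> v; rewrite /push /push_dir.
  have l0 := least_ge0 sg x0.
  case: (boolP (v \in sg)) => vs.
    have -> : (v == a) = false by apply/eqP => va; move: asg; rewrite -va vs.
    rewrite mulr0 sub0r mulrN1 subr_ge0; apply: le_trans (least_le x vs).
    by rewrite ler_piMl.
  by rewrite subr0; rewrite addr_ge0 // !mulr_ge0.
- move=> v vs; rewrite /push /push_dir xs //.
  move: vs; rewrite !inE negb_or => /andP[/negbTE -> /negbTE ->].
  by rewrite mulr0 subrr mulr0 addr0.
- by rewrite /push big_split /= x1 -mulr_sumr sum_push_dir // mulr0 addr0.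
Qed.

(** At [c = 1] a vertex of [sg] with the least coordinate has lost all its mass, and the point lies
    in the face opposite to it. *)
Lemma push_face sg a x : a \notin sg -> sg != fset0 ->
  closed_simplex (a |` sg)%fset x ->
  exists2 v, v \in sg & closed_simplex ((a |` sg) `\ v)%fset (push sg a 1 x).
Proof.
move=> asg sg0 sx.
have [v vs lv] := leastP sg0 (fun v => closed_simplex_le1 v sx).
exists v => //.
have p1 := push_simplex asg ler01 (lexx 1) sx.
have -> : ((a |` sg) `\ v = ((a |` sg) `\ v) `&` (a |` sg))%fset.
  by apply/esym/fsetIidPl; exact: fsubD1set.
apply: closed_simplex_sub => // w wt; rewrite in_fsetD1 wt andbT negbK => /eqP ->.
rewrite /push lv /push_dir vs; have -> : (v == a) = false.
  by apply/eqP => va; move: asg; rewrite -va vs.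
by rewrite mulr0 sub0r mul1r mulrN1 subrr.
Qed.

Lemma continuous_least sg : continuous (least sg).
Proof.
apply: continuous_big; last by move=> v _; exact: continuous_eval.
by apply: continuous_minr; [exact: continuous_fst|exact: continuous_snd].
Qed.

Lemma continuous_push (T : topologicalType) sg a (c : T -> R) (f : T -> {ptws V -> R}) :
  continuous c -> continuous f -> continuous (fun p => push sg a (c p) (f p)).
Proof.
move=> cc cf; apply: continuous_ptws => v.
have cv : continuous (fun p => f p v).
  apply: (@continuous_funcomp _ _ _ (fun x : {ptws V -> R} => x v) f) => //.
  exact: continuous_eval.
have cl : continuous (fun p => least sg (f p)).
  exact: continuous_funcomp (@continuous_least sg) cf.
by move=> p; apply: cvgD; [exact: cv|apply: cvgMl; apply: cvgM; [exact: cc|exact: cl]].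
Qed.

End push.

(** * Collapses and expansions *)

Section collapse.
Variables (R : realType) (V : choiceType) (K : simplicial_complex V).
(** [M sg a] selects [sg] as a free face of the simplex spanned by [a] and [sg]. By [M_uniq] no
    selected simplex contains the free face of another, so all collapses, even infinitely many, are
    performed at once. *)
Variable M : {fset V} -> V -> Prop.
Hypothesis M_simplex : forall sg a, M sg a ->
  [/\ a \notin sg, sg != fset0 & simplices K (a |` sg)%fset].
Hypothesis M_free : forall sg a s, M sg a -> simplices K s ->
  (sg `<=` s)%fset -> (s `<=` a |` sg)%fset.
Hypothesis M_uniq : forall sg a sg' a', M sg a -> M sg' a' ->
  (sg' `<=` a |` sg)%fset -> sg' = sg /\ a' = a.

Definition collapsed_simplices : set {fset V} :=
  [set s | simplices K s /\ forall sg a, M sg a -> ~~ (sg `<=` s)%fset].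

Lemma collapsed_neq0 s : collapsed_simplices s -> s != fset0.
Proof. by case=> /simplices_neq0. Qed.

Lemma collapsed_sub s t : collapsed_simplices s -> (t `<=` s)%fset ->
  t != fset0 -> collapsed_simplices t.
Proof.
move=> [Ks sM] ts t0; split; first exact: simplices_sub Ks ts t0.
by move=> sg a Ma; apply: contra (sM sg a Ma) => /fsubset_trans; apply.
Qed.

Definition collapsed : simplicial_complex V :=
  SimplicialComplex collapsed_neq0 collapsed_sub.

Let active (x : {ptws V -> R}) (p : {fset V} * V) :=
  M p.1 p.2 /\ forall v, v \in p.1 -> x v != 0.

(** At most one pair is active at a point of the realization, by [M_free] and [M_uniq], so the
    choice made by [cid] is immaterial; [deform_in] records this. *)
Let deform (c : R) (x : {ptws V -> R}) : {ptws V -> R} :=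
  if pselect (exists p, active x p) is left e
  then push (projT1 (cid e)).1 (projT1 (cid e)).2 c x else x.

Let active_sub s x p : closed_simplex s x -> active x p -> (p.1 `<=` s)%fset.
Proof.
move=> [_ xs _] [_ xp]; apply/fsubsetP => v /xp; apply: contraNT => /xs ->.
by rewrite eqxx.
Qed.

Let deform_in s sg a c x : M sg a -> (sg `<=` s)%fset -> simplices K s ->
  closed_simplex s x -> deform c x = push sg a c x.
Proof.
move=> Ma sgs Ks sx; rewrite /deform; case: pselect => [e|ne].
  case: cid => -[sg' a'] /= act; have [Ma' _] := act.
  have sub := fsubset_trans (active_sub sx act) (M_free Ma Ks sgs).
  by have [/= -> ->] := M_uniq Ma Ma' sub.
rewrite push_id //; have [v vs xv] : exists2 v, v \in sg & x v = 0.
  apply: contrapT => nv; apply: ne; exists (sg, a); split => //= v vs.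
  by apply/eqP => xv; apply: nv; exists v.
by have [x0 _ _] := sx; exact: least_eq0 x0 vs xv.
Qed.

Let deform_out s c x : collapsed_simplices s -> closed_simplex s x ->
  deform c x = x.
Proof.
move=> [Ks sM] sx; rewrite /deform; case: pselect => // e.
exfalso; case: e => p act; have [Mp _] := act.
by move: (sM _ _ Mp); rewrite (active_sub sx act).
Qed.

Let collapsed_dec s : simplices K s ->
  collapsed_simplices s \/ exists sg a, M sg a /\ (sg `<=` s)%fset.
Proof.
move=> Ks; have [h|h] := pselect (exists sg a, M sg a /\ (sg `<=` s)%fset).
  by right.
left; split => // sg a Ma; apply/negP => sub; apply: h; by exists sg, a.
Qed.

Let deform_point c x : 0 <= c -> c <= 1 -> realization_points K x ->
  realization_points K (deform c x).
Proof.
move=> c0 c1 [s Ks sx]; have [cs|[sg [a [Ma sgs]]]] := collapsed_dec Ks.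
  by rewrite (deform_out _ cs sx); exists s.
have [asg sg0 Kt] := M_simplex Ma.
rewrite (deform_in _ Ma sgs Ks sx); exists (a |` sg)%fset => //.
apply: push_simplex => //; exact: closed_simplexS (M_free Ma Ks sgs) sx.
Qed.

Let collapsed_face sg a v : M sg a -> v \in sg ->
  collapsed_simplices ((a |` sg) `\ v)%fset.
Proof.
move=> Ma vs; have [asg sg0 Kt] := M_simplex Ma.
have av : a != v by apply: contraNneq asg => ->.
split.
  apply: simplices_sub Kt (fsubD1set _ _) _; apply/fset0Pn; exists a.
  by rewrite !inE av eqxx.
move=> sg' a' Ma'; apply/negP => sub.
have [E _] := M_uniq Ma Ma' (fsubset_trans sub (fsubD1set _ _)).
by move/fsubsetP: sub => /(_ v); rewrite E vs !inE eqxx => /(_ isT).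
Qed.

Let deform1_point x : realization_points K x ->
  realization_points collapsed (deform 1 x).
Proof.
move=> [s Ks sx]; have [cs|[sg [a [Ma sgs]]]] := collapsed_dec Ks.
  by rewrite (deform_out _ cs sx); exists s.
have [asg sg0 Kt] := M_simplex Ma.
rewrite (deform_in _ Ma sgs Ks sx).
have [v vs fx] := push_face asg sg0 (closed_simplexS (M_free Ma Ks sgs) sx).
by exists ((a |` sg) `\ v)%fset => //; exact: collapsed_face Ma vs.
Qed.

Let incl_point (x : {ptws V -> R}) : realization_points collapsed x -> realization_points K x.
Proof. by move=> [s [Ks _] sx]; exists s. Qed.

Theorem collapse_equivalent :
  strong_equivalent R (realization R K) (realization R collapsed).
Proof.
pose f (x : realization R K) : realization R collapsed :=
  Realization (deform1_point (realization_coordP x)).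
pose g (x : realization R collapsed) : realization R K :=
  Realization (incl_point (realization_coordP x)).
pose H (p : realization R K * R) : realization R K :=
  Realization (deform_point (clamp_ge0 p.2) (clamp_le1 p.2) (realization_coordP p.1)).
have cf : continuous f.
  apply: realization_map => s Ks; have [cs|[sg [a [Ma sgs]]]] := collapsed_dec Ks.
    exists id, [:: s]; split; first by move=> x; exact: cvg_id.
      by move=> t; rewrite inE => /eqP ->.
    move=> x sx; rewrite /= (deform_out _ cs sx); split => //.
    by exists s => //; rewrite inE.
  have [asg sg0 Kt] := M_simplex Ma.
  exists (push sg a 1), [seq ((a |` sg) `\ v)%fset | v <- sg]; split.
  - by apply: continuous_push => [|x]; [exact: cst_continuous|exact: cvg_id].
  - by move=> t /mapP[v vs ->]; exact: collapsed_face Ma vs.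
  - move=> x sx; rewrite /= (deform_in _ Ma sgs Ks sx); split => //.
    have [v vs fx] := push_face asg sg0 (closed_simplexS (M_free Ma Ks sgs) sx).
    by exists ((a |` sg) `\ v)%fset => //; apply/mapP; exists v.
have cg : continuous g.
  apply: realization_map => s cs; exists id, [:: s]; split.
  - by move=> x; exact: cvg_id.
  - by move=> t; rewrite inE => /eqP ->; case: cs.
  - by move=> x sx; split => //; exists s => //; rewrite inE.
have cH : continuous H.
  apply: realization_homotopy => s Ks; have [cs|[sg [a [Ma sgs]]]] := collapsed_dec Ks.
    exists fst, [:: s]; split; first exact: continuous_fst.
      by move=> t; rewrite inE => /eqP ->.
    move=> x t sx; rewrite /= (deform_out _ cs sx); split => //.
    by exists s => //; rewrite inE.
  have [asg sg0 Kt] := M_simplex Ma.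
  exists (fun p => push sg a (clamp p.2) p.1), [:: (a |` sg)%fset]; split.
  - apply: continuous_push; last exact: continuous_fst.
    by apply: continuous_clamp; exact: continuous_snd.
  - by move=> t; rewrite inE => /eqP ->.
  - move=> x t sx; rewrite /= (deform_in _ Ma sgs Ks sx); split => //.
    exists (a |` sg)%fset; rewrite ?inE //.
    apply: push_simplex; rewrite ?clamp_ge0 ?clamp_le1 //.
    exact: closed_simplexS (M_free Ma Ks sgs) sx.
exists f, g; split => //.
- apply: global_homotopic_sym; exists H; split => // x; apply: realization_inj => v /=.
    rewrite clamp0 // /deform; case: pselect => // e; by rewrite push0.
  by rewrite clamp1.
(* No pair is active on the collapsed complex: the deformation is the identity there, and the
   constant homotopy suffices. *)
- exists (fun p => p.1); split => //; first exact: continuous_fst.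
  move=> x; apply: realization_inj => v /=.
  by have [s cs sx] := realization_coordP x; rewrite (deform_out _ cs sx).
Qed.

End collapse.

Definition stage (V : choiceType) (v0 : V) (M : nat -> {fset V} -> V -> Prop)
    (k : nat) : set {fset V} := [set s | s = [fset v0]%fset \/
  exists j sg a, [/\ (j < k)%N, M j sg a & s = sg \/ s = (a |` sg)%fset]].

(* The subcomplexes [stage k] of [K] start from the point [v0]; [stage k.+1] is
   obtained from [stage k] by adding, for each [sg] and [a] with [M k sg a], the
   simplex [a |` sg] together with its free face [sg]. *)
Record expansions (V : choiceType) (K : simplicial_complex V) (v0 : V)
    (M : nat -> {fset V} -> V -> Prop) : Prop := Expansions {
  expansions_base : simplices K [fset v0]%fset;
  expansions_finite : forall k, finite_set [set p : {fset V} * V | M k p.1 p.2];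
  expansions_simplex : forall k sg a, M k sg a ->
    [/\ a \notin sg, sg != fset0 & simplices K (a |` sg)%fset];
  expansions_face : forall k sg a t, M k sg a -> (t `<=` a |` sg)%fset ->
    t != fset0 -> t != sg -> t != (a |` sg)%fset -> stage v0 M k t;
  expansions_new : forall k sg a k' sg' a', M k sg a -> M k' sg' a' ->
    (sg' `<=` a |` sg)%fset -> (k' < k)%N \/ [/\ k' = k, sg' = sg & a' = a];
  expansions_new_base : forall k sg a, M k sg a -> sg != [fset v0]%fset
}.

(** * Contraction of an infinite tower of expansions *)

Section expansions.
Variables (R : realType) (V : choiceType) (K : simplicial_complex V).
Variables (v0 : V) (M : nat -> {fset V} -> V -> Prop).
Hypothesis expM : expansions K v0 M.

Let base_simplex := expansions_base expM.
Let M_finite := expansions_finite expM.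
Let M_simplex := expansions_simplex expM.
Let M_face := expansions_face expM.
Let M_uniq := expansions_new expM.
Let M_base := expansions_new_base expM.

Local Notation stage := (stage v0 M).

Lemma stageW j k s : (j <= k)%N -> stage j s -> stage k s.
Proof.
move=> jk [->|[i [sg [a [ij Ma h]]]]]; [by left|right].
by exists i, sg, a; split => //; exact: leq_trans ij jk.
Qed.

Lemma stage_top k sg a : M k sg a -> stage k.+1 (a |` sg)%fset.
Proof. by move=> Ma; right; exists k, sg, a; split => //; right. Qed.

Lemma stageS k s : stage k.+1 s -> stage k s \/
  exists sg a, M k sg a /\ (s `<=` a |` sg)%fset.
Proof.
move=> [->|[j [sg [a [jk Ma h]]]]]; first by left; left.
move: jk; rewrite ltnS leq_eqVlt => /orP[/eqP E|jk].
  right; exists sg, a; rewrite -E; split => //.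
  by case: h => ->; [exact: fsubsetU1|exact: fsubset_refl].
by left; right; exists j, sg, a.
Qed.

Lemma stage_simplex k s : stage k s -> simplices K s.
Proof.
move=> [->//|[j [sg [a [jk Ma h]]]]]; have [asg sg0 Kt] := M_simplex Ma.
by case: h => -> //; apply: simplices_sub Kt _ sg0; exact: fsubsetU1.
Qed.

Lemma stage_sub k s t : stage k s -> (t `<=` s)%fset -> t != fset0 -> stage k t.
Proof.
move=> [->|[j [sg [a [jk Ma h]]]]] ts t0.
  by move: ts; rewrite fsubset1 (negbTE t0) orbF => /eqP ->; left.
have {}ts : (t `<=` a |` sg)%fset.
  by apply: fsubset_trans ts _; case: h => ->; [exact: fsubsetU1|exact: fsubset_refl].
have [->|tsg] := eqVneq t sg; first by right; exists j, sg, a; split => //; left.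
have [->|tta] := eqVneq t (a |` sg)%fset.
  by right; exists j, sg, a; split => //; right.
exact: stageW (ltnW jk) (M_face Ma ts t0 tsg tta).
Qed.

(** A free face is new at its own rank: nothing present earlier contains it. This is why [step k]
    fixes the points of stage [k]. *)
Lemma stage_lt k s k' sg' a' : stage k s -> M k' sg' a' -> (sg' `<=` s)%fset ->
  (k' < k)%N.
Proof.
move=> [->|[j [sg [a [jk Ma h]]]]] Ma' sub.
  have [_ sg0 _] := M_simplex Ma'; have := M_base Ma'.
  by move: sub; rewrite fsubset1 (negbTE sg0) orbF => ->.
have {}sub : (sg' `<=` a |` sg)%fset.
  by apply: fsubset_trans sub _; case: h => ->; [exact: fsubsetU1|exact: fsubset_refl].
by case: (M_uniq Ma Ma' sub) => [k'j|[-> _ _]//]; exact: ltn_trans k'j jk.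
Qed.

Definition level k := fset_set [set p : {fset V} * V | M k p.1 p.2].

Lemma mem_level k p : p \in level k <-> M k p.1 p.2.
Proof. by rewrite /level in_fset_set; [rewrite inE|exact: M_finite]. Qed.

Lemma stage_finite k : exists F : seq {fset V}, forall s, s \in F <-> stage k s.
Proof.
elim: k => [|k [F hF]].
  exists [:: [fset v0]%fset] => s; rewrite inE; split; first by move=> /eqP ->; left.
  by case=> [->//|[j [sg [a []]]]].
exists (F ++ [seq p.1 | p <- level k] ++ [seq (p.2 |` p.1)%fset | p <- level k]) => s.
rewrite !mem_cat; split.
  case/or3P => [/hF|/mapP[p /mem_level Mp ->]|/mapP[p /mem_level Mp ->]].
  - exact: stageW.
  - by right; exists k, p.1, p.2; split => //; left.
  - by right; exists k, p.1, p.2; split => //; right.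
case=> [->|[j [sg [a [jk Ma h]]]]]; first by apply/orP; left; apply/hF; left.
move: jk; rewrite ltnS leq_eqVlt => /orP[/eqP E|jk]; last first.
  by apply/orP; left; apply/hF; right; exists j, sg, a.
rewrite E in Ma; apply/orP; right; apply/orP.
by case: h => ->; [left|right]; apply/mapP; exists (sg, a) => //; exact/mem_level.
Qed.

Implicit Types x : {ptws V -> R}.

Definition stage_point k x := exists2 s, stage k s & closed_simplex s x.

Lemma stage_pointW j k x : (j <= k)%N -> stage_point j x -> stage_point k x.
Proof. by move=> jk [s js sx]; exists s => //; exact: stageW js. Qed.

(** All collapses of rank [k] at once. On stage [k.+1] at most one summand is nonzero, and a finite
    sum instead of a choice makes continuity immediate. *)
Definition step k (c : R) x : {ptws V -> R} := fun v =>
  x v + c * \sum_(p <- level k) least p.1 x * push_dir R p.1 p.2 v.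

Lemma step0 k x : step k 0 x = x.
Proof. by apply/funext => v; rewrite /step mul0r addr0. Qed.

Let least_out s k' sg' a' x : closed_simplex s x ->
  ~ (sg' `<=` s)%fset -> M k' sg' a' -> least sg' x = 0.
Proof.
move=> [x0 xs _] nsub _; have [v vsg vs] : exists2 v, v \in sg' & v \notin s.
  by apply/fsubsetPn/negP.
by apply: least_eq0 vsg _ => //; exact: xs.
Qed.

Lemma step_out k s c x : stage k s -> closed_simplex s x -> step k c x = x.
Proof.
move=> ks sx; apply/funext => v; rewrite /step big_seq big1 ?mulr0 ?addr0 //.
move=> p /mem_level Mp; rewrite (least_out sx _ Mp) ?mul0r // => sub.
by have := stage_lt ks Mp sub; rewrite ltnn.
Qed.

Lemma step_in k sg a c x : M k sg a -> closed_simplex (a |` sg)%fset x ->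
  step k c x = push sg a c x.
Proof.
move=> Ma sx; apply/funext => v; rewrite /step /push -mulrA; congr (_ + _ * _).
have ml : (sg, a) \in level k by apply/mem_level.
rewrite (sum_fsetD1 (fun p => least p.1 x * push_dir R p.1 p.2 v) ml) /=.
rewrite big_seq big1 ?addr0 // => -[sg' a']; rewrite in_fsetD1 => /andP[ne /mem_level /= Ma'].
rewrite (least_out sx _ Ma') ?mul0r // => sub.
have [|[_ E1 E2]] := M_uniq Ma Ma' sub; first by rewrite ltnn.
by move: ne; rewrite E1 E2 eqxx.
Qed.

Lemma continuous_step (T : topologicalType) k (c : T -> R) (f : T -> {ptws V -> R}) :
  continuous c -> continuous f -> continuous (fun p => step k (c p) (f p)).
Proof.
move=> cc cf; apply: continuous_ptws => v.
have cv : continuous (fun p => f p v).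
  apply: (@continuous_funcomp _ _ _ (fun x : {ptws V -> R} => x v) f) => //.
  exact: continuous_eval.
have cl : continuous (fun p => \sum_(r <- level k) least r.1 (f p) * push_dir R r.1 r.2 v).
  apply: continuous_sum => r p; apply: cvgMl.
  exact: (@continuous_funcomp _ _ _ (least r.1) f (@continuous_least R V r.1) cf p).
by move=> p; apply: cvgD; [exact: cv|apply: cvgM; [exact: cc|exact: cl]].
Qed.

(* The collapses of rank [k] are performed for times in [1/(k+2), 1/(k+1)], so
   that those of higher rank, infinitely many of them, come first. *)
Definition clock (k : nat) (t : R) : R := clamp ((k.+2%:R * t - 1) * k.+1%:R).

Lemma clock0 k : clock k 0 = 0.
Proof. by rewrite /clock clamp0 // mulr0 sub0r mulN1r oppr_le0. Qed.

Lemma clock1 k : clock k 1 = 1.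
Proof.
rewrite /clock clamp1 // mulr1.
have -> : k.+2%:R - 1 = k.+1%:R :> R by rewrite -[k.+2]addn1 natrD addrK.
by rewrite -natrM ler1n muln_gt0.
Qed.

(** Rank [k] ends at time 1/(k+1), and rank [j] starts at time 1/(j+2), which is no earlier. *)
Lemma clock_lt j k t : (j < k)%N -> clock k t != 1 -> clock j t = 0.
Proof.
move=> jk h; rewrite /clock clamp0 // pmulr_lle0 // subr_le0.
rewrite leNgt; apply: contra h => h; apply/eqP; rewrite /clock clamp1 //.
have t0 : 0 < t by rewrite -(pmulr_rgt0 _ (ltr0Sn R j.+1)); exact: lt_trans h.
have k1 : 1 < k.+1%:R * t.
  by apply: lt_le_trans h _; rewrite ler_pM2r // ler_nat.
have -> : k.+2%:R * t - 1 = t + (k.+1%:R * t - 1) by rewrite -[k.+2]addn1 natrD; ring.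
have k0 : 0 < k.+1%:R :> R by [].
have : 1 <= t * k.+1%:R by rewrite mulrC ltW.
move/le_trans; apply; rewrite ler_pM2r // lerDl subr_ge0; exact: ltW.
Qed.

Fixpoint flow (j : nat) (t : R) x : {ptws V -> R} :=
  if j is i.+1 then flow i t (step i (clock i t) x) else x.

Lemma flow0 j x : flow j 0 x = x.
Proof. by elim: j x => //= j IH x; rewrite clock0 step0. Qed.

(** Steps of rank at least [j] fix stage [j], so all long enough truncations agree at a point of the
    tower: this gives a meaning to the infinite composition. *)
Lemma flow_stage j k t x : stage_point j x -> (j <= k)%N -> flow k t x = flow j t x.
Proof.
move=> [s js sx]; elim: k => [|k IH]; first by rewrite leqn0 => /eqP ->.
rewrite leq_eqVlt => /orP[/eqP -> //|]; rewrite ltnS => jk /=.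
by rewrite (step_out _ (stageW jk js) sx) IH.
Qed.

Lemma flow_early j t x : clock j t != 1 -> flow j t x = x.
Proof.
have: forall i, (i < j)%N -> clock j t != 1 -> clock i t = 0 by move=> i ij; exact: clock_lt.
move=> h c1; have {h} : forall i, (i < j)%N -> clock i t = 0 by move=> i /h; exact.
by elim: j x {c1} => //= j IH x h; rewrite h // step0 IH // => i ij; apply: h; exact: ltnW.
Qed.

(** The completed push ends in a face that contains [a] and misses a vertex of [sg]; it is neither
    of the two new simplices, so it was already there. *)
Lemma step1_stage k x : stage_point k.+1 x -> stage_point k (step k 1 x).
Proof.
move=> [s ks sx]; have [{}ks|[sg [a [Ma sub]]]] := stageS ks.
  by rewrite (step_out _ ks sx); exists s.
have [asg sg0 _] := M_simplex Ma; have tx := closed_simplexS sub sx.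
rewrite (step_in _ Ma tx); have [v vs fx] := push_face asg sg0 tx.
exists ((a |` sg) `\ v)%fset => //.
have av : a != v by apply: contraNneq asg => ->.
have aF : a \in ((a |` sg) `\ v)%fset by rewrite !inE av eqxx.
apply: M_face Ma _ _ _ _; first exact: fsubD1set.
- by apply/fset0Pn; exists a.
- by apply: contraNneq asg => <-.
- by apply: contraTneq (fset1Ur a vs) => <-; rewrite !inE eqxx.
Qed.

Lemma flow_point j t x : stage_point j x -> stage_point j (flow j t x).
Proof.
elim: j x => //= j IH x px.
(* Either rank [j] has finished, and the point is back in stage [j], or it has not, and all lower
   ranks are still at rest. *)
have [c1|c1] := eqVneq (clock j t) 1.
  by rewrite c1; apply: stage_pointW (leqnSn j) _; apply: IH; exact: step1_stage.
rewrite flow_early //; have [s ks sx] := px.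
have [{}ks|[sg [a [Ma sub]]]] := stageS ks; first by rewrite (step_out _ ks sx).
have [asg sg0 _] := M_simplex Ma; have tx := closed_simplexS sub sx.
rewrite (step_in _ Ma tx); exists (a |` sg)%fset; first exact: stage_top.
by apply: push_simplex => //; [exact: clamp_ge0|exact: clamp_le1].
Qed.

Lemma flow1 j x : stage_point j x -> closed_simplex [fset v0]%fset (flow j 1 x).
Proof.
elim: j x => [|j IH] x /=.
  by case=> s [->|[j [sg [a []]]]].
by move=> px; apply: IH; rewrite clock1; exact: step1_stage.
Qed.

Lemma continuous_flow (T : topologicalType) j (c : T -> R) (f : T -> {ptws V -> R}) :
  continuous c -> continuous f -> continuous (fun p => flow j (c p) (f p)).
Proof.
move=> cc; elim: j f => //= j IH f cf; apply: (IH (fun p => step j (clock j (c p)) (f p))).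
apply: continuous_step => //; apply: continuous_clamp => p.
apply: cvgMl; apply: cvgB; last exact: cvg_cst.
by apply: cvgMr; exact: cc.
Qed.

End expansions.

(** * Wedges of spheres *)

Section triangle.
Variables (R : realType) (V : choiceType) (s : {fset V}).
Hypothesis s3 : #|` s| = 3%N.
Implicit Types x : {ptws V -> R}.

(** Normalized to be 1 at the barycenter and 0 on the boundary; along rays from the barycenter, 1
    minus the centrality is proportional to the distance. *)
Definition centrality x : R := 3%:R * least s x.

Definition barycenter (v : V) : R := (v \in s)%:R / 3%:R.

(* The central part of the triangle is stretched radially, at time [t] up to the
   boundary, and the remaining collar is projected onto the boundary. *)
Definition stretch (t : R) x : {ptws V -> R} := fun v =>
  barycenter v + (x v - barycenter v) / (1 - Num.min (centrality x) (t / 2%:R)).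

Let s0 : s != fset0. Proof. by rewrite -cardfs_gt0 s3. Qed.

Lemma sum_const_triangle (c : R) : \sum_(v <- s) c = 3%:R * c.
Proof.
rewrite big_const_seq count_predT iter_addr_0 -[size _]/(#|` s|) s3.
by rewrite mulr_natl.
Qed.

Lemma centrality_ge0 x : closed_simplex s x -> 0 <= centrality x.
Proof. by move=> [x0 _ _]; rewrite /centrality mulr_ge0 // least_ge0. Qed.

Lemma centrality_le x v : v \in s -> centrality x <= 3%:R * x v.
Proof. by move=> vs; rewrite /centrality ler_pM2l // least_le. Qed.

Lemma centralityP x : closed_simplex s x ->
  exists2 v, v \in s & centrality x = 3%:R * x v.
Proof.
move=> sx; have [v vs lv] := leastP s0 (fun v => closed_simplex_le1 v sx).
by exists v => //; rewrite /centrality lv.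
Qed.

Lemma centrality_eq0 x v : closed_simplex s x -> v \in s -> x v = 0 -> centrality x = 0.
Proof. by move=> [x0 _ _] vs xv; rewrite /centrality (least_eq0 x0 vs xv) mulr0. Qed.

Lemma sum_barycenter : \sum_(v <- s) barycenter v = 1.
Proof.
rewrite big_seq (eq_bigr (fun=> 3%:R^-1)) -?big_seq.
  by rewrite sum_const_triangle divff // pnatr_eq0.
by move=> v vs; rewrite /barycenter vs mul1r.
Qed.

Let collar x (t : R) : 0 <= t -> t <= 1 -> 0 < 1 - Num.min (centrality x) (t / 2%:R).
Proof.
move=> t0 t1; rewrite subr_gt0; apply: le_lt_trans (_ : t / 2%:R < 1); last lra.
by rewrite ge_min lexx orbT.
Qed.

Lemma stretch_simplex (t : R) x : 0 <= t -> t <= 1 -> closed_simplex s x ->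
  closed_simplex s (stretch t x).
Proof.
move=> t0 t1 sx; have [x0 xs x1] := sx; have m1 := collar x t0 t1.
set m := Num.min _ _ in m1.
split.
- move=> v; rewrite /stretch /barycenter -/m.
  case: (boolP (v \in s)) => vs; last by rewrite mul0r add0r subr0 divr_ge0 ?x0 // ltW.
  rewrite mul1r -(@pmulr_lge0 _ (1 - m)) // mulrDl -mulrA mulVf ?gt_eqF // mulr1.
  have : m <= 3%:R * x v.
    by apply: le_trans (centrality_le x vs); rewrite /m ge_min lexx.
  lra.
- move=> v vs; rewrite /stretch /barycenter (negbTE vs) xs //.
  by rewrite mul0r subr0 mul0r addr0.
- rewrite /stretch big_split /= sum_barycenter -mulr_suml sumrB x1 sum_barycenter.
  by rewrite subrr mul0r addr0.
Qed.

(** In the collar the denominator is 1 minus the centrality, so the map is radial projection from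
    the barycenter: a least coordinate, which is (1 - centrality)/3 below 1/3, goes to 0. *)
Lemma stretch_face (t : R) x : 0 <= t -> t <= 1 -> closed_simplex s x ->
  centrality x <= t / 2%:R ->
  exists2 v, v \in s & closed_simplex (s `\ v)%fset (stretch t x).
Proof.
move=> t0 t1 sx xt; have [v vs dv] := centralityP sx; exists v => //.
have -> : (s `\ v = (s `\ v) `&` s)%fset by apply/esym/fsetIidPl; exact: fsubD1set.
apply: closed_simplex_sub; first exact: stretch_simplex.
move=> w ws; rewrite in_fsetD1 ws andbT negbK => /eqP ->.
have := collar x t0 t1; rewrite /stretch /barycenter vs (min_idPl xt) dv => m1.
have -> : x v - 1 / 3%:R = - 3%:R^-1 * (1 - 3%:R * x v) by lra.
by rewrite mulfK ?gt_eqF // mul1r subrr.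
Qed.

Lemma stretch0 (t : R) x : closed_simplex s x -> 0 <= t ->
  t = 0 \/ centrality x = 0 -> stretch t x = x.
Proof.
move=> sx t0 h; have d0 := centrality_ge0 sx; apply/funext => v; rewrite /stretch.
have -> : Num.min (centrality x) (t / 2%:R) = 0.
  case: h => ->; first by rewrite mul0r; apply/min_idPr.
  by apply/min_idPl; rewrite divr_ge0.
by rewrite subr0 divr1 addrC subrK.
Qed.

Lemma continuous_centrality : continuous centrality.
Proof.
apply: (@continuous_mul _ _ (fun=> 3%:R) (least s)); first exact: cst_continuous.
exact: continuous_least.
Qed.

Lemma continuous_stretch :
  continuous (fun p : {ptws V -> R} * R => stretch (clamp p.2) p.1).
Proof.
have cc : continuous (fun p : {ptws V -> R} * R => clamp p.2 : R).
  by apply: continuous_clamp; exact: continuous_snd.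
apply: continuous_ptws => v.
have cv : continuous (fun p : {ptws V -> R} * R => p.1 v).
  apply: (@continuous_funcomp _ _ _ (fun x : {ptws V -> R} => x v) fst).
    exact: continuous_eval.
  exact: continuous_fst.
have cm : continuous (fun p : {ptws V -> R} * R => Num.min (centrality p.1) (clamp p.2 / 2%:R)).
  apply: continuous_minr.
    exact: continuous_funcomp continuous_centrality (@continuous_fst _ _).
  by apply: continuous_mul cc _; exact: cst_continuous.
apply: continuous_add; first exact: cst_continuous.
apply: continuous_mul; first by apply: continuous_sub => //; exact: cst_continuous.
have c1 := @continuous_sub _ _ (fun=> 1) _ (@cst_continuous _ _ _) cm.
move=> p; apply: (cvgV _ (c1 p)).
by rewrite gt_eqF // collar // ?clamp_ge0 ?clamp_le1.
Qed.

End triangle.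

(** * A triangle wrapped around the sphere *)

Section wrap.
Variables (R : realType) (V : choiceType) (a b c : V).
Hypotheses (ab : a != b) (ac : a != c) (bc : b != c).
Implicit Types x y : {ptws V -> R}.

Let s := [fset a; b; c]%fset.

Lemma card_triangle : #|` s| = 3%N.
Proof.
by rewrite /s fsetUC cardfsU1 cardfs2 !inE negb_or !(eq_sym c) ab ac bc.
Qed.

Lemma sum_triangle (f : V -> R) : \sum_(v <- s) f v = f a + f b + f c.
Proof.
have aS : a \in s by rewrite !inE eqxx.
have bS : b \in (s `\ a)%fset by rewrite !inE eqxx eq_sym ab orbT.
rewrite (sum_fsetD1 f aS) (sum_fsetD1 f bS) addrA; congr (_ + _).
rewrite (_ : ((s `\ a) `\ b = [fset c])%fset) ?big_seq_fset1 //.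
apply/fsetP => v; rewrite !inE.
have [->|_] := eqVneq v a; first by rewrite (negbTE ac) andbF.
by have [->|_] := eqVneq v b; first by rewrite (negbTE bc).
Qed.

Definition wrap_den x : R :=
  (x a - 3%:R^-1) ^+ 2 + (x b - 3%:R^-1) ^+ 2 + centrality s x ^+ 2.

(* In the affine coordinates [u], [w] centered at the barycenter and with [d]
   the centrality, this is the inverse stereographic projection of
   [(u / d, w / d)]; the boundary of the triangle, [d = 0], is sent to the base
   point of the sphere. *)
Definition sphere_wrap x : 'rV[R]_3 := \row_i
  [:: ((x a - 3%:R^-1) ^+ 2 + (x b - 3%:R^-1) ^+ 2 - centrality s x ^+ 2) / wrap_den x;
      2%:R * centrality s x * (x a - 3%:R^-1) / wrap_den x;
      2%:R * centrality s x * (x b - 3%:R^-1) / wrap_den x]`_i.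

Lemma triangle_sum x : closed_simplex s x -> x a + x b + x c = 1.
Proof. by move=> [_ _ <-]; rewrite sum_triangle. Qed.

Lemma triangle_centrality x : closed_simplex s x ->
  [/\ centrality s x <= 3%:R * x a, centrality s x <= 3%:R * x b,
      centrality s x <= 3%:R * x c &
      [\/ centrality s x = 3%:R * x a, centrality s x = 3%:R * x b |
        centrality s x = 3%:R * x c]].
Proof.
move=> sx; split; try by apply: centrality_le; rewrite !inE eqxx ?orbT.
have [v] := centralityP card_triangle sx.
by rewrite !inE -orbA => /or3P[] /eqP -> h; [constructor 1|constructor 2|constructor 3].
Qed.

(** The first two squares vanish together only at the barycenter, where the centrality is 1. *)
Lemma wrap_den_gt0 x : closed_simplex s x -> 0 < wrap_den x.
Proof.
move=> sx; have s1 := triangle_sum sx.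
have [_ _ _ h] := triangle_centrality sx.
rewrite lt_neqAle eq_sym /wrap_den !addr_ge0 ?sqr_ge0 // andbT.
rewrite !paddr_eq0 ?addr_ge0 ?sqr_ge0 // !sqrf_eq0.
apply/negP => /andP[/andP[/eqP xa /eqP xb] /eqP d0].
by case: h; lra.
Qed.

Lemma wrap_sphere x : closed_simplex s x -> sphere_set (sphere_wrap x).
Proof.
move=> /wrap_den_gt0 D0; rewrite /sphere_set /= !big_ord_recl big_ord0 !mxE /=.
move: D0; rewrite /wrap_den; set u := x a - _; set w := x b - _; set d := centrality s x.
by move=> D0; field; rewrite gt_eqF.
Qed.

Lemma wrap_boundary x : closed_simplex s x -> centrality s x = 0 ->
  sphere_wrap x = delta_mx ord0 ord0.
Proof.
move=> sx d0; have := wrap_den_gt0 sx; rewrite /wrap_den d0 expr0n /= addr0 => D0.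
apply/rowP => i; rewrite !mxE /wrap_den d0 expr0n /= subr0 addr0.
by case: i => [[|[|[|]]]] //= _; rewrite ?mulr0 ?mul0r ?divff ?gt_eqF.
Qed.

Let cross_eq (p d p' d' : R) :
  (p - d) * (p' + d') = (p' - d') * (p + d) -> d * (p' + d') = d' * (p + d).
Proof. lra. Qed.

Lemma wrap_eq x y : closed_simplex s x -> closed_simplex s y -> sphere_wrap x = sphere_wrap y ->
  [/\ centrality s x ^+ 2 * wrap_den y = centrality s y ^+ 2 * wrap_den x,
     centrality s x * (x a - 3%:R^-1) * wrap_den y =
       centrality s y * (y a - 3%:R^-1) * wrap_den x &
     centrality s x * (x b - 3%:R^-1) * wrap_den y =
       centrality s y * (y b - 3%:R^-1) * wrap_den x].
Proof.
move=> sx sy E; have Dx := wrap_den_gt0 sx; have Dy := wrap_den_gt0 sy.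
have cross (p q : R) : p / wrap_den x = q / wrap_den y ->
    p * wrap_den y = q * wrap_den x.
  move=> h; have -> : p = q / wrap_den y * wrap_den x by rewrite -h divfK ?gt_eqF.
  by rewrite mulrAC divfK ?gt_eqF.
have E0 := congr1 (fun r : 'rV[R]_3 => r ord0 ord0) E.
have E1 := congr1 (fun r : 'rV[R]_3 => r ord0 (Ordinal (isT : (1 < 3)%N))) E.
have E2 := congr1 (fun r : 'rV[R]_3 => r ord0 (Ordinal (isT : (2 < 3)%N))) E.
rewrite !mxE /= in E0 E1 E2; move/cross: E0; move/cross: E1; move/cross: E2.
move=> E2 E1 E0; split.
- by move: E0; rewrite /wrap_den => E0; exact: cross_eq E0.
- move: (centrality s x) (centrality s y) E1 => d d' E1.
  by apply: (@mulfI _ 2%:R); rewrite ?pnatr_eq0 // !mulrA.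
- move: (centrality s x) (centrality s y) E2 => d d' E2.
  by apply: (@mulfI _ 2%:R); rewrite ?pnatr_eq0 // !mulrA.
Qed.

Lemma wrap_base x : closed_simplex s x -> sphere_wrap x = delta_mx ord0 ord0 ->
  centrality s x = 0.
Proof.
move=> sx E; have Dx := wrap_den_gt0 sx.
have := congr1 (fun r : 'rV[R]_3 => r ord0 ord0) E; rewrite !mxE /= => E0.
have {}E0 : (x a - 3%:R^-1) ^+ 2 + (x b - 3%:R^-1) ^+ 2 - centrality s x ^+ 2 = wrap_den x.
  by rewrite -[LHS](@divfK _ (wrap_den x)) ?gt_eqF // E0 mul1r.
by apply/eqP; rewrite -sqrf_eq0; apply/eqP; rewrite /wrap_den in E0; lra.
Qed.

(** Let d be the centrality of [x]. On the ray from the barycenter, a least coordinate of [x] bounds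
    the centrality of [y] by 1 - r (1 - d). As it equals r d, [r] is at most 1. *)
Let ratio x y (r : R) : closed_simplex s x -> closed_simplex s y ->
  0 < r -> centrality s y = r * centrality s x ->
  y a - 3%:R^-1 = r * (x a - 3%:R^-1) -> y b - 3%:R^-1 = r * (x b - 3%:R^-1) ->
  r <= 1.
Proof.
move=> sx sy r0 rd ra rb.
have [_ _ _ hx] := triangle_centrality sx; have [ya yb yc _] := triangle_centrality sy.
have sx1 := triangle_sum sx; have sy1 := triangle_sum sy.
by case: hx => h; rewrite h in rd; nra.
Qed.

(** Equal images have equal plane coordinates u / d and w / d, so [x] and [y] lie on one ray, at the
    ratio [r] of their centralities; [ratio] used both ways gives [r = 1]. *)
Lemma wrap_inj x y : closed_simplex s x -> closed_simplex s y ->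
  centrality s x != 0 -> sphere_wrap x = sphere_wrap y -> x = y.
Proof.
move=> sx sy dx E; have Dx := wrap_den_gt0 sx; have Dy := wrap_den_gt0 sy.
have [E0 E1 E2] := wrap_eq sx sy E.
have dx0 : 0 < centrality s x by rewrite lt_neqAle eq_sym dx centrality_ge0.
have dy0 : 0 < centrality s y.
  rewrite lt_neqAle centrality_ge0 // andbT eq_sym; apply: contraNneq dx => dy.
  apply/eqP; apply: wrap_base => //; rewrite E; exact: wrap_boundary.
set r := centrality s y / centrality s x.
have r0 : 0 < r by rewrite divr_gt0.
have rd : centrality s y = r * centrality s x by rewrite /r divfK ?gt_eqF.
have rD : wrap_den y = r ^+ 2 * wrap_den x.
  apply: (@mulfI _ (centrality s x ^+ 2)); first by rewrite sqrf_eq0.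
  by rewrite E0 rd exprMn; ring.
have nz : r * centrality s x * wrap_den x != 0.
  by apply: lt0r_neq0; apply: mulr_gt0 => //; apply: mulr_gt0.
have ra : y a - 3%:R^-1 = r * (x a - 3%:R^-1).
  apply: (mulfI nz).
  by move: E1; rewrite rD rd => E1; lra.
have rb : y b - 3%:R^-1 = r * (x b - 3%:R^-1).
  apply: (mulfI nz).
  by move: E2; rewrite rD rd => E2; lra.
have r1 : r = 1.
  apply/eqP; rewrite eq_le (ratio sx sy r0 rd ra rb) /=.
  rewrite -[r]invrK invf_ge1 ?invr_gt0 //.
  by apply: (ratio sy sx); rewrite ?invr_gt0 // ?rd ?ra ?rb mulKf ?gt_eqF.
have xya : x a = y a by move: ra; rewrite r1; lra.
have xyb : x b = y b by move: rb; rewrite r1; lra.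
have xyc : x c = y c by have := triangle_sum sx; have := triangle_sum sy; lra.
apply/funext => v; case: (boolP (v \in s)) => vs.
  by move: vs; rewrite !inE -orbA => /or3P[] /eqP ->.
by have [_ -> // _] := sx; have [_ -> //] := sy.
Qed.

Lemma wrap_surj (p : 'rV[R]_3) : sphere_set p ->
  exists2 x, closed_simplex s x & sphere_wrap x = p.
Proof.
rewrite /sphere_set /= !big_ord_recl big_ord0 addr0.
set A := p _ _; set B := p _ _; set C := p _ _ => ABC.
have pE (i : 'I_3) : p ord0 i = [:: A; B; C]`_i.
  by case: i => [[|[|[|]]]] //= i3; rewrite /A /B /C; congr (p _ _); exact: val_inj.
pose pt (xa xb xc : R) : {ptws V -> R} := fun v =>
  if v == a then xa else if v == b then xb else if v == c then xc else 0.
have pta xa xb xc : pt xa xb xc a = xa by rewrite /pt eqxx.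
have ptb xa xb xc : pt xa xb xc b = xb by rewrite /pt eq_sym (negbTE ab) eqxx.
have ptc xa xb xc : pt xa xb xc c = xc.
  by rewrite /pt !(eq_sym c) (negbTE ac) (negbTE bc) eqxx.
have ptS xa xb xc : 0 <= xa -> 0 <= xb -> 0 <= xc -> xa + xb + xc = 1 ->
    closed_simplex s (pt xa xb xc).
  move=> a0 b0 c0 x1; split.
  - by move=> v; rewrite /pt; do !case: ifP.
  - by move=> v; rewrite !inE !negb_or /pt => /andP[/andP[/negbTE -> /negbTE ->] /negbTE ->].
  - by rewrite sum_triangle pta ptb ptc.
(* The base point is the image of the whole boundary; the corner [a] serves as a preimage. *)
have [A1|A1] := eqVneq A 1.
  have B0 : B = 0 by apply/eqP; rewrite -sqrf_eq0; apply/eqP; rewrite A1 in ABC; nra.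
  have C0 : C = 0 by apply/eqP; rewrite -sqrf_eq0; apply/eqP; rewrite A1 in ABC; nra.
  have sx : closed_simplex s (pt 1 0 0) by apply: ptS; rewrite ?addr0.
  exists (pt 1 0 0) => //; rewrite wrap_boundary //.
    apply/rowP => i; rewrite pE !mxE /= A1 B0 C0.
    by case: i => [[|[|[|]]]].
  by apply: (@centrality_eq0 _ _ _ _ b) => //; rewrite !inE eqxx ?orbT.
have A1' : 0 < 1 - A.
  have : A <= 1 by nra.
  by rewrite le_eqVlt (negbTE A1) /= subr_gt0.
(* [z1] and [z2] are the stereographic projection of [p] from the base point; [z3] makes the
   displacement from the barycenter sum to 0. *)
pose z1 := B / (1 - A); pose z2 := C / (1 - A); pose z3 := - z1 - z2.
have zB : B = z1 * (1 - A) by rewrite /z1 divfK ?gt_eqF.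
have zC : C = z2 * (1 - A) by rewrite /z2 divfK ?gt_eqF.
have zz : (z1 ^+ 2 + z2 ^+ 2 + 1) * (1 - A) = 2%:R.
  apply: (@mulIf _ (1 - A)); first by rewrite gt_eqF.
  by move: ABC; rewrite zB zC; nra.
pose m := Num.min z1 (Num.min z2 z3).
have [m1 m2 m3] : [/\ m <= z1, m <= z2 & m <= z3].
  by rewrite /m !ge_min !lexx ?orbT.
have mm : [\/ m = z1, m = z2 | m = z3].
  rewrite /m /Num.min; case: ifP => _; first by constructor 1.
  by case: ifP => _; [constructor 2|constructor 3].
have m0 : m <= 0 by rewrite /z3 in m3; lra.
(* The preimage is sought with coordinates 1/3 + d z and centrality d. Its least coordinate is 1/3 +
   d m, whence d = 1 + 3 d m. *)
pose d := (1 - 3%:R * m)^-1.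
have dm : d * (1 - 3%:R * m) = 1 by rewrite /d mulVf // gt_eqF //; lra.
have d0 : 0 < d by rewrite /d invr_gt0; lra.
pose X := pt (3%:R^-1 + d * z1) (3%:R^-1 + d * z2) (3%:R^-1 + d * z3).
have sX : closed_simplex s X.
  by apply: ptS; rewrite /z3 in m3 *; nra.
have Xa : X a = 3%:R^-1 + d * z1 by exact: pta.
have Xb : X b = 3%:R^-1 + d * z2 by exact: ptb.
have Xc : X c = 3%:R^-1 + d * z3 by exact: ptc.
have dX : centrality s X = d.
  have [la lb lc h] := triangle_centrality sX; rewrite Xa Xb Xc in la lb lc h.
  apply/eqP; rewrite eq_le; apply/andP; split.
    by case: mm => e; rewrite e in dm; nra.
  by case: h => ->; nra.
exists X => //.
have DX : wrap_den X = d ^+ 2 * (z1 ^+ 2 + z2 ^+ 2 + 1).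
  by rewrite /wrap_den dX Xa Xb; ring.
have D0 := wrap_den_gt0 sX.
have Dz : wrap_den X * (1 - A) = 2%:R * d ^+ 2 by rewrite DX -mulrA zz; ring.
have key (u q : R) : u * (1 - A) = q * (2%:R * d ^+ 2) -> u / wrap_den X = q.
  move=> h; apply: (@mulIf _ (wrap_den X)); first by rewrite gt_eqF.
  rewrite divfK ?gt_eqF //; apply: (@mulIf _ (1 - A)); first by rewrite gt_eqF.
  by rewrite h -Dz mulrA.
apply/rowP => i; rewrite pE mxE dX Xa Xb /=.
have -> : 3%:R^-1 + d * z1 - 3%:R^-1 = d * z1 by ring.
have -> : 3%:R^-1 + d * z2 - 3%:R^-1 = d * z2 by ring.
case: i => [[|[|[|]]]] //= i3.
- apply: key; have -> : (d * z1) ^+ 2 + (d * z2) ^+ 2 - d ^+ 2 =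
      d ^+ 2 * ((z1 ^+ 2 + z2 ^+ 2 + 1) - 2%:R) by ring.
  by rewrite -mulrA mulrBl zz; ring.
- by apply: key; rewrite zB; ring.
- by apply: key; rewrite zC; ring.
Qed.

(** Continuity is claimed only at points of the triangle: elsewhere the denominator may vanish. *)
Lemma continuous_at_wrap x : closed_simplex s x -> {for x, continuous sphere_wrap}.
Proof.
move=> sx.
have cx v : continuous (fun x : {ptws V -> R} => x v - 3%:R^-1).
  by apply: continuous_sub; [exact: continuous_eval|exact: cst_continuous].
have cd := @continuous_centrality R V s.
have cD : continuous wrap_den.
  apply: continuous_add; last exact: continuous_mul.
  by apply: continuous_add; exact: continuous_mul.
have c0 : continuous (fun x => (x a - 3%:R^-1) ^+ 2 + (x b - 3%:R^-1) ^+ 2 - centrality s x ^+ 2).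
  apply: continuous_sub; last exact: continuous_mul.
  by apply: continuous_add; exact: continuous_mul.
have c2 : continuous (fun x => 2%:R * centrality s x).
  by apply: continuous_mul => //; exact: cst_continuous.
have c1 v : continuous (fun x => 2%:R * centrality s x * (x v - 3%:R^-1)).
  exact: continuous_mul.
have c3 (f : {ptws V -> R} -> R) (j : 'I_3) : continuous f ->
    (forall y, sphere_wrap y ord0 j = f y / wrap_den y) ->
    {for x, continuous (fun y : {ptws V -> R} => sphere_wrap y ord0 j)}.
  move=> cf E; rewrite (_ : (fun _ => _) = fun y : {ptws V -> R} => f y / wrap_den y).
    by apply: continuous_at_div => //; rewrite gt_eqF // wrap_den_gt0.
  exact/funext.
pose o1 : 'I_3 := Ordinal (isT : (1 < 3)%N).
pose o2 : 'I_3 := Ordinal (isT : (2 < 3)%N).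
have h0 := c3 _ ord0 c0 (fun y => mxE _ _ _ _).
have h1 := c3 _ o1 (c1 a) (fun y => mxE _ _ _ _).
have h2 := c3 _ o2 (c1 b) (fun y => mxE _ _ _ _).
move=> A [P hP PA].
have n0 : nbhs x [set y | P ord0 ord0 (sphere_wrap y ord0 ord0)].
  by apply: h0; exact: hP.
have n1 : nbhs x [set y | P ord0 o1 (sphere_wrap y ord0 o1)] by apply: h1; exact: hP.
have n2 : nbhs x [set y | P ord0 o2 (sphere_wrap y ord0 o2)] by apply: h2; exact: hP.
apply: (@filterS3 _ (nbhs x) _ _ _ _ _ _ n0 n1 n2) => y p0 p1 p2; apply: PA => i j; rewrite (ord1 i).
have [->|[->|->]] : j = ord0 \/ j = o1 \/ j = o2; [|exact: p0|exact: p1|exact: p2].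
by case: j => [[|[|[|]]]] //= j3; [left|right; left|right; right]; exact: val_inj.
Qed.

End wrap.

Lemma cardfs2_ex (T : choiceType) (s : {fset T}) : #|` s| = 2%N ->
  exists a b, a != b /\ s = [fset a; b]%fset.
Proof.
move=> s2; have s0 : s != fset0 by rewrite -cardfs_gt0 s2.
have [a sa] := fset0Pn _ s0.
have c1 : #|` (s `\ a)%fset| = 1%N by have := cardfsD1 a s; rewrite sa s2 /= add1n => -[<-].
have s1 : (s `\ a)%fset != fset0 by rewrite -cardfs_gt0 c1.
have [b] := fset0Pn _ s1; rewrite in_fsetD1 => /andP[ba sb].
exists a, b; split; first by rewrite eq_sym.
apply/esym/eqP; rewrite eqEfcard s2 cardfs2 (eq_sym a) ba andbT.
by apply/fsubsetP => v; rewrite !inE => /orP[] /eqP ->.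
Qed.

Lemma cardfs3_ex (T : choiceType) (s : {fset T}) : #|` s| = 3%N ->
  exists a b c, [/\ a != b, a != c, b != c & s = [fset a; b; c]%fset].
Proof.
move=> s3; have s0 : s != fset0 by rewrite -cardfs_gt0 s3.
have [a sa] := fset0Pn _ s0.
have c2 : #|` (s `\ a)%fset| = 2%N by have := cardfsD1 a s; rewrite sa s3 /= add1n => -[<-].
have [b [c [bc E]]] := cardfs2_ex c2.
have : b \in (s `\ a)%fset by rewrite E !inE eqxx.
have : c \in (s `\ a)%fset by rewrite E !inE eqxx orbT.
rewrite !in_fsetD1 => /andP[ca _] /andP[ba _].
exists a, b, c; split; [by rewrite eq_sym|by rewrite eq_sym|by []|].
by rewrite -[LHS](fsetD1K sa) E fsetUA.
Qed.

(** * The quotient map onto the wedge *)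

Section bouquet.
Variables (R : realType) (V : choiceType) (K : simplicial_complex V) (v0 : V).
Variable M : nat -> {fset V} -> V -> Prop.
Hypothesis expM : expansions K v0 M.
Variable e : nat -> {fset V}.
Hypothesis e_critical : forall s, (exists n, s = e n) <->
  simplices K s /\ forall k, ~ stage v0 M k s.
Hypothesis e_inj : injective e.
Hypothesis e3 : forall n, #|` e n| = 3%N.
Implicit Types x : {ptws V -> R}.

Local Notation stage_point := (stage_point v0 M).

Let e_simplex n : simplices K (e n).
Proof. by have [|] := (e_critical (e n)).1 _; first by exists n. Qed.

Let e_new n k : ~ stage v0 M k (e n).
Proof. by have [|] := (e_critical (e n)).1 _; first by exists n. Qed.

Let dichotomy s : simplices K s -> (exists k, stage v0 M k s) \/ exists n, s = e n.
Proof.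
move=> Ks; have [|h] := pselect (exists k, stage v0 M k s); first by left.
by right; apply/e_critical; split => // k ks; apply: h; exists k.
Qed.

Let e_sub_eq n t : (t `<=` e n)%fset -> #|` t| = 3%N -> t = e n.
Proof. by move=> sub t3; apply/eqP; rewrite eqEfcard sub e3 t3. Qed.

(** A proper face of a critical triangle has fewer than three vertices, so it is not critical and
    lies in some stage; the faces are finite in number, and the stages increase. *)
Let boundary_stage n : exists j, forall t, (t `<=` e n)%fset -> t != fset0 ->
  t != e n -> stage v0 M j t.
Proof.
have [j hj] : exists j, forall t, t \in enum_fset (fpowerset (e n)) -> t != fset0 ->
    t != e n -> stage v0 M j t.
  have : forall t, t \in enum_fset (fpowerset (e n)) -> (t `<=` e n)%fset.
    by move=> t; rewrite -[_ \in _]/(t \in fpowerset (e n)) fpowersetE.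
  elim: (enum_fset _) => [|u l IH] sub; first by exists 0%N.
  have [|j hj] := IH; first by move=> t tl; apply: sub; rewrite inE tl orbT.
  have sue : (u `<=` e n)%fset by apply: sub; rewrite inE eqxx.
  have [i hi] : exists i, u != fset0 -> u != e n -> stage v0 M i u.
    have [->|u0] := eqVneq u fset0; first by exists 0%N.
    have [[i hi]|[m um]] := dichotomy (simplices_sub (e_simplex n) sue u0).
      by exists i.
    by exists 0%N => _; rewrite (e_sub_eq sue) ?eqxx // um e3.
  exists (maxn i j) => t; rewrite inE => /orP[/eqP ->|tl] t0 tn.
    by apply: stageW (leq_maxl i j) _; exact: hi.
  by apply: stageW (leq_maxr i j) _; exact: hj.
by exists j => t te; apply: hj; rewrite -[_ \in _]/(t \in fpowerset (e n)) fpowersetE.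
Qed.

Let J n : nat := projT1 (cid (boundary_stage n)).

Let JP n t : (t `<=` e n)%fset -> t != fset0 -> t != e n -> stage v0 M (J n) t.
Proof. exact: (projT2 (cid (boundary_stage n))). Qed.

Let simplex_neq0 s x : closed_simplex s x -> s != fset0.
Proof.
move=> [_ _ s1]; apply: contra_eq_neq s1 => ->.
by rewrite big_seq_fset0 eq_sym oner_neq0.
Qed.

Let boundary_point n s x : closed_simplex (e n) x -> closed_simplex s x ->
  ~ (e n `<=` s)%fset -> stage_point (J n) x /\ centrality (e n) x = 0.
Proof.
move=> ex sx /negP /fsubsetPn[v ve vs].
have x0 w : w \in e n -> w \notin s -> x w = 0 by move=> _; have [_ + _] := sx; apply.
have tx := closed_simplex_sub ex x0.
split; last exact: centrality_eq0 ex ve (x0 v ve vs).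
exists (s `&` e n)%fset => //; apply: JP; first exact: fsubsetIr.
  exact: simplex_neq0 tx.
by apply: contraNneq vs => E; move: ve; rewrite -{1}E in_fsetI => /andP[].
Qed.

Let critical_stage n j x : closed_simplex (e n) x -> stage_point j x ->
  stage_point (J n) x /\ centrality (e n) x = 0.
Proof.
move=> ex [s js sx]; apply: boundary_point ex sx _ => sub.
by apply: (@e_new n j); apply: stage_sub expM _ _ _ js sub _; rewrite -cardfs_gt0 e3.
Qed.

Let critical2 n m x : n != m -> closed_simplex (e n) x -> closed_simplex (e m) x ->
  stage_point (J n) x /\ centrality (e n) x = 0.
Proof.
move=> nm ex sx; apply: boundary_point ex sx _ => sub.
by move/eqP: nm; apply; apply: e_inj; exact: e_sub_eq.
Qed.

Let central0 n x : closed_simplex (e n) x -> centrality (e n) x = 0 ->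
  stage_point (J n) x.
Proof.
move=> ex; have [v ve ->] := centralityP (e3 n) ex => /eqP.
rewrite mulf_eq0 pnatr_eq0 /= => /eqP xv.
have sub : (e n `\ v `<=` e n)%fset by exact: fsubD1set.
have fx : closed_simplex (e n `\ v)%fset x.
  rewrite -[(e n `\ v)%fset](fsetIidPl sub).
  apply: closed_simplex_sub ex _ => w we; rewrite in_fsetD1 we andbT negbK.
  by move=> /eqP ->.
by have [] := boundary_point ex fx _ => // /fsubsetP /(_ v ve); rewrite !inE eqxx.
Qed.

Let point_cases x : realization_points K x ->
  (exists j, stage_point j x) \/ exists n, closed_simplex (e n) x.
Proof.
move=> [s Ks sx]; have [[k ks]|[n E]] := dichotomy Ks; last by right; exists n; rewrite -E.
by left; exists k, s.
Qed.

Let flow_eq i j t x : stage_point i x -> stage_point j x -> flow M i t x = flow M j t x.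
Proof.
move=> pi pj; rewrite -(flow_stage expM t pi (leq_maxl i j)).
by rewrite (flow_stage expM t pj (leq_maxr i j)).
Qed.

(** Extends the flow from the boundary to the triangle. A point of the collar is carried to the
    boundary and flows for the time t - 2 centrality: for all of t if it started on the boundary,
    not at all at the inner rim, where the centrality is t/2. Further inside only the stretching
    acts. *)
Let shrink n x (t : R) : {ptws V -> R} :=
  flow M (J n) (Num.max 0 (clamp t - 2%:R * centrality (e n) x))
    (stretch (e n) (clamp t) x).

Let shrink_stage n j x t : closed_simplex (e n) x -> stage_point j x ->
  shrink n x t = flow M j (clamp t) x.
Proof.
move=> ex px; have [pJ c0] := critical_stage ex px.
rewrite /shrink c0 mulr0 subr0 (max_idPr (clamp_ge0 t)).
rewrite (stretch0 ex (clamp_ge0 t)); last by right.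
exact: flow_eq.
Qed.

Let shrink_point n x t : closed_simplex (e n) x ->
  closed_simplex (e n) (shrink n x t) \/ stage_point (J n) (shrink n x t).
Proof.
move=> ex; have t0 := clamp_ge0 t; have t1 := clamp_le1 t.
have [ct|ct] := leP (centrality (e n) x) (clamp t / 2%:R).
  have [v ve fx] := stretch_face (e3 n) t0 t1 ex ct.
  right; apply: flow_point expM _ _ _ _; exists (e n `\ v)%fset => //.
  apply: JP; first exact: fsubD1set.
    exact: simplex_neq0 fx.
  by apply: contraTneq ve => <-; rewrite !inE eqxx.
have m0 : Num.max 0 (clamp t - 2%:R * centrality (e n) x) = 0 by apply/max_idPl; lra.
left; rewrite /shrink m0 flow0.
exact (stretch_simplex (e3 n) t0 t1 ex).
Qed.

(** The choices are immaterial: two critical triangles, or such a triangle and a stage, meet only in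
    the boundary, where [shrink] is the flow. *)
Let contraction x (t : R) : {ptws V -> R} :=
  if pselect (exists n, closed_simplex (e n) x) is left h
  then shrink (projT1 (cid h)) x t
  else if pselect (exists j, stage_point j x) is left h
  then flow M (projT1 (cid h)) (clamp t) x else x.

Let contraction_stage j x t : stage_point j x -> contraction x t = flow M j (clamp t) x.
Proof.
move=> px; rewrite /contraction; case: pselect => [h|_].
  by case: cid => n /= ex; exact: shrink_stage.
case: pselect => [h|[]]; last by exists j.
by case: cid => i /= pi; exact: flow_eq.
Qed.

Let contraction_critical n x t : closed_simplex (e n) x -> contraction x t = shrink n x t.
Proof.
move=> ex; rewrite /contraction; case: pselect => [h|[]]; last by exists n.
case: cid => m /= mx; have [->//|mn] := eqVneq m n.
have [pm _] := critical2 mn mx ex.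
by rewrite (shrink_stage _ mx pm) (shrink_stage _ ex pm).
Qed.

Let contraction_point x t : realization_points K x ->
  realization_points K (contraction x t).
Proof.
move=> /point_cases[[j px]|[n ex]].
  rewrite (contraction_stage _ px).
  by have [s js sx] := flow_point expM (clamp t) px; exists s => //; exact: stage_simplex expM _ _ js.
rewrite (contraction_critical _ ex); case: (shrink_point t ex) => [h|[s js sx]].
  by exists (e n).
by exists s => //; exact: stage_simplex expM _ _ js.
Qed.

Let H (p : realization R K * R) : realization R K :=
  Realization (contraction_point p.2 (realization_coordP p.1)).

Let H_continuous : continuous H.
Proof.
apply: realization_homotopy => s Ks; have [[k ks]|[n E]] := dichotomy Ks.
  have [F FP] := stage_finite expM k.
  exists (fun p => flow M k (clamp p.2) p.1), F; split.
  - apply: continuous_flow; last exact: continuous_fst.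
    by apply: continuous_clamp; exact: continuous_snd.
  - by move=> t /FP; exact: stage_simplex.
  - move=> x t sx; have px : stage_point k x by exists s.
    rewrite /= (contraction_stage _ px); split => //.
    by have [u ku ux] := flow_point expM (clamp t) px; exists u => //; exact/FP.
have [F FP] := stage_finite expM (J n).
exists (fun p => shrink n p.1 p.2), (e n :: F); split.
- have cc : continuous (fun p : {ptws V -> R} * R => clamp p.2 : R).
    by apply: continuous_clamp; exact: continuous_snd.
  apply: (@continuous_flow R V M _ (J n)
    (fun p => Num.max 0 (clamp p.2 - 2%:R * centrality (e n) p.1))).
    apply: continuous_maxr; first exact: cst_continuous.
    apply: continuous_sub => //; apply: continuous_mul; first exact: cst_continuous.
    exact: continuous_funcomp (@continuous_centrality R V (e n)) (@continuous_fst _ _).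
  exact: continuous_stretch.
- move=> t; rewrite inE => /orP[/eqP -> //|/FP]; exact: stage_simplex.
- move=> x t; rewrite E => ex; rewrite /= (contraction_critical _ ex); split => //.
  case: (shrink_point t ex) => [h|[u ju ux]]; first by exists (e n); rewrite ?inE ?eqxx.
  by exists u => //; rewrite inE; apply/orP; right; exact/FP.
Qed.

Let H0 (x : realization R K) : H (x, 0) = x.
Proof.
apply: realization_inj => v /=.
have [[j px]|[n ex]] := point_cases (realization_coordP x).
  by rewrite (contraction_stage _ px) clamp0 // flow0.
have m0 : Num.max 0 (0 - 2%:R * centrality (e n) x) = 0.
  by apply/max_idPl; rewrite sub0r oppr_le0 mulr_ge0 // centrality_ge0.
rewrite (contraction_critical _ ex) /shrink clamp0 // m0 flow0 (stretch0 ex) //.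
by left.
Qed.

Let H1 j k (x y : realization R K) : stage_point j x -> stage_point k y ->
  H (x, 1) = H (y, 1).
Proof.
move=> px py; apply: realization_inj => v /=.
rewrite (contraction_stage _ px) (contraction_stage _ py) clamp1 //.
have [_ x0 x1] := flow1 expM px; have [_ y0 y1] := flow1 expM py.
have [->|vv0] := eqVneq v v0; last by rewrite x0 ?y0 // inE.
by rewrite big_seq_fset1 in x1; rewrite big_seq_fset1 in y1; rewrite x1.
Qed.

Let H_stage j (x : realization R K) t : stage_point j x -> exists k, stage_point k (H (x, t)).
Proof.
move=> px; exists j; rewrite /= (contraction_stage _ px).
exact (flow_point expM (clamp t) px).
Qed.

Let corners : exists w : nat -> V * V * V, forall n,
  [/\ (w n).1.1 != (w n).1.2, (w n).1.1 != (w n).2, (w n).1.2 != (w n).2 &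
     e n = [fset (w n).1.1; (w n).1.2; (w n).2]%fset].
Proof.
suff h : forall n, exists w : V * V * V, [/\ w.1.1 != w.1.2, w.1.1 != w.2, w.1.2 != w.2 &
    e n = [fset w.1.1; w.1.2; w.2]%fset].
  by have [w hw] := choice h; exists w.
by move=> n; have [a [b [c ?]]] := cardfs3_ex (e3 n); exists (a, b, c).
Qed.

Let wrapn n : {ptws V -> R} -> 'rV[R]_3 :=
  let w := projT1 (cid corners) n in sphere_wrap w.1.1 w.1.2 w.2.

Let sphere_of (p : 'rV[R]_3) : sphere R 2 :=
  if pselect (sphere_set p) is left h then SigSub (mem_set h) else sphere_base R 2.

Let val_sphere_of p : sphere_set p -> set_val (sphere_of p) = p.
Proof. by move=> hp; rewrite /sphere_of; case: pselect. Qed.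

Let wrapn_sphere n x : closed_simplex (e n) x -> sphere_set (wrapn n x).
Proof. by have [h1 h2 h3 ->] := projT2 (cid corners) n; exact: wrap_sphere. Qed.

Let wrapn_boundary n x : closed_simplex (e n) x -> centrality (e n) x = 0 ->
  wrapn n x = delta_mx ord0 ord0.
Proof. by have [h1 h2 h3 ->] := projT2 (cid corners) n; exact: wrap_boundary. Qed.

Let wrapn_base n x : closed_simplex (e n) x -> wrapn n x = delta_mx ord0 ord0 ->
  centrality (e n) x = 0.
Proof. by have [h1 h2 h3 ->] := projT2 (cid corners) n; exact: wrap_base. Qed.

Let wrapn_inj n x y : closed_simplex (e n) x -> closed_simplex (e n) y ->
  centrality (e n) x != 0 -> wrapn n x = wrapn n y -> x = y.
Proof. by have [h1 h2 h3 ->] := projT2 (cid corners) n; exact: wrap_inj. Qed.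

Let wrapn_surj n (p : 'rV[R]_3) : sphere_set p ->
  exists2 x, closed_simplex (e n) x & wrapn n x = p.
Proof. by have [h1 h2 h3 ->] := projT2 (cid corners) n; exact: wrap_surj. Qed.

Let wrapn_continuous n x : closed_simplex (e n) x -> {for x, continuous (wrapn n)}.
Proof. by have [h1 h2 h3 ->] := projT2 (cid corners) n; exact: continuous_at_wrap. Qed.

Let base : sphere R 2 := sphere_base R 2.
Local Notation W := (countable_sphere_wedge R 2).
Let lift n : sphere R 2 -> W := @wedge_lift nat (fun _ => sphere R 2) (fun _ => base) n.

Let lift_base n m : lift n base = lift m base.
Proof. exact: (@wedge_liftE nat (fun _ => sphere R 2) (fun _ => base) m base n base). Qed.

Let lift_eq n m p r : lift n p = lift m r -> n = m /\ p = r \/ p = base /\ r = base.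
Proof.
move=> E.
(* [f k] induces the retraction of the wedge onto its sphere number [k], sending the other spheres
   to the base point. *)
pose f k (i : nat) (y : sphere R 2) := if i == k then y else base.
have fE k i j : f k i base = f k j base by rewrite /f; case: ifP; case: ifP.
have F k i y : wedge_fun (f k) (lift i y) = f k i y by exact: wedge_lift_funE.
have En := congr1 (wedge_fun (f n)) E; rewrite !F /f eqxx in En.
have Em := congr1 (wedge_fun (f m)) E; rewrite !F /f eqxx in Em.
by move: En Em; rewrite (eq_sym m n); case: eqP => [->|_] hn hm; [left|right].
Qed.

(** Points on no critical triangle go to the base point, which all spheres share; hence the
    arbitrary index 0. *)
Let collapse_map (x : realization R K) : W :=
  if pselect (exists n, closed_simplex (e n) x) is left h
  then let n := projT1 (cid h) in lift n (sphere_of (wrapn n x))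
  else lift 0%N base.

Let sphere_of_boundary n x : closed_simplex (e n) x -> centrality (e n) x = 0 ->
  sphere_of (wrapn n x) = base.
Proof.
move=> ex c0; apply: val_inj; rewrite [LHS]val_sphere_of; last exact: wrapn_sphere.
exact: wrapn_boundary.
Qed.

Let collapse_stage j (x : realization R K) : stage_point j x ->
  collapse_map x = lift 0%N base.
Proof.
move=> px; rewrite /collapse_map; case: pselect => // h; case: cid => n /= ex.
have [_ c0] := critical_stage ex px.
by rewrite (sphere_of_boundary ex c0); exact: lift_base.
Qed.

Let collapse_critical n (x : realization R K) : closed_simplex (e n) x ->
  collapse_map x = lift n (sphere_of (wrapn n x)).
Proof.
move=> ex; rewrite /collapse_map; case: pselect => [h|[]]; last by exists n.
case: cid => m /= mx; have [->//|mn] := eqVneq m n.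
have nm : n != m by rewrite eq_sym.
have [_ cm] := critical2 mn mx ex; have [_ cn] := critical2 nm ex mx.
by rewrite (sphere_of_boundary mx cm) (sphere_of_boundary ex cn); exact: lift_base.
Qed.

(** The wrapping is injective inside each triangle, and only the boundary reaches the base point; so
    nothing is identified except points in the union of the stages. *)
Let collapse_fiber (x y : realization R K) : collapse_map x = collapse_map y ->
  x = y \/ exists i j, stage_point i x /\ stage_point j y.
Proof.
have base_stage n (z : realization R K) : closed_simplex (e n) z ->
    sphere_of (wrapn n z) = base -> stage_point (J n) z.
  move=> ez E; apply: central0 => //; apply: wrapn_base => //.
  by rewrite -(val_sphere_of (wrapn_sphere ez)) E.
have [[i px]|[n ex]] := point_cases (realization_coordP x);
  have [[j py]|[m my]] := point_cases (realization_coordP y).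
- by move=> _; right; exists i, j.
- rewrite (collapse_stage px) (collapse_critical my) => /lift_eq [[_ E]|[_ E]];
    by right; exists i, (J m); split => //; apply: base_stage => //; rewrite -?E.
- rewrite (collapse_stage py) (collapse_critical ex) => /lift_eq [[_ E]|[E _]];
    by right; exists (J n), j; split => //; apply: base_stage.
rewrite (collapse_critical ex) (collapse_critical my).
move=> /lift_eq [[nm E]|[Ex Ey]]; last first.
  by right; exists (J n), (J m); split; apply: base_stage.
have [c0|c0] := eqVneq (centrality (e n) x) 0.
  right; exists (J n), (J m); split; first exact: central0.
  by apply: base_stage => //; rewrite -E (sphere_of_boundary ex).
left; rewrite -nm in my E.
have F : wrapn n x = wrapn n y.
  by rewrite -(val_sphere_of (wrapn_sphere ex)) E (val_sphere_of (wrapn_sphere my)).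
by apply: realization_inj => v; rewrite (wrapn_inj ex my c0 F).
Qed.

Let collapse_surj (w : W) : exists x : realization R K, collapse_map x = w.
Proof.
have : (\bigcup_n (@wedge_lift nat (fun _ => sphere R 2) (fun _ => base) n) @` setT) w.
  by rewrite wedgeTE.
move=> [n _ [p _ <-]].
have [x ex xp] := wrapn_surj n (set_valP p).
have px : realization_points K x by exists (e n).
exists (Realization px); rewrite (@collapse_critical n) //=; congr (lift n _).
by apply: val_inj; rewrite [LHS]val_sphere_of; [exact: xp|exact: wrapn_sphere].
Qed.

Let continuous_to_sphere (T : topologicalType) (f : T -> sphere R 2) :
  continuous (fun t => set_val (f t)) -> continuous f.
Proof.
move=> /continuousP cf; apply/continuousP => U [B oB <-]; exact: cf.
Qed.

Let collapse_continuous : continuous collapse_map.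
Proof.
apply: realization_continuous => s Ks; have [[k ks]|[n E]] := dichotomy Ks.
  rewrite (_ : _ \o _ = fun=> lift 0%N base); first exact: cst_continuous.
  by apply/funext => x /=; apply: (@collapse_stage k); exists s => //; exact: set_valP.
have exs (x : @closed_simplex R V s) : closed_simplex (e n) (set_val x).
  by rewrite -E; exact: set_valP.
rewrite (_ : _ \o _ = fun x : @closed_simplex R V s => lift n (sphere_of (wrapn n (set_val x)))).
  apply: (@continuous_funcomp _ _ _ (lift n)).
    exact (@wedge_lift_continuous nat (fun _ => sphere R 2) (fun _ => base) n).
  apply: continuous_to_sphere => x.
  rewrite (_ : (fun _ => _) = fun x : @closed_simplex R V s => wrapn n (set_val x)); last first.
    by apply/funext => y; rewrite val_sphere_of //; exact: wrapn_sphere.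
  apply: (@continuous_comp _ _ _ set_val (wrapn n)); first exact: initial_continuous.
  exact: wrapn_continuous.
by apply/funext => x; exact (@collapse_critical n (simplex_point Ks x) (exs x)).
Qed.

Let closed_simplex_compact (s : {fset V}) : compact (@closed_simplex R V s).
Proof.
apply: (subclosed_compact (@closed_simplex_closed R V s)
  (@tychonoff V (fun=> R) (fun=> `[0, 1]%classic) (fun=> @segment_compact R 0 1))).
move=> x sx v /=; rewrite in_itv /= (closed_simplex_le1 v sx) andbT.
by have [x0 _ _] := sx.
Qed.

(** A closed triangle is compact, so its wrapping is a closed map: the part of the triangle outside
    the preimage has a closed image, whose complement is the trace of [U] on the sphere. *)
Let collapse_quotient (U : set W) : open (collapse_map @^-1` U) -> open U.
Proof.
move=> oU; apply/wedge_openP => n.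
have oU' : realization_open (collapse_map @^-1` U) by exact: oU.
have [B oB UB] := oU' _ (e_simplex n).
pose Z : set {ptws V -> R} := closed_simplex (e n) `&` ~` B.
have cZ : compact Z.
  by apply: compact_closedI; [exact: closed_simplex_compact|exact: open_closedC].
have cB : closed (wrapn n @` Z).
  apply: compact_closed; first exact: norm_hausdorff.
  apply: continuous_compact => //; apply: continuous_in_subspaceT => x.
  by rewrite inE => -[ex _]; exact: wrapn_continuous.
exists (~` (wrapn n @` Z)); first exact: closed_openC.
have key (x : realization R K) p : closed_simplex (e n) x -> wrapn n x = set_val p ->
    collapse_map x = lift n p.
  move=> ex xp; rewrite (collapse_critical ex); congr (lift n _); apply: val_inj.
  by rewrite [LHS]val_sphere_of //; exact: wrapn_sphere.
apply/seteqP; split => p /=.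
  move=> nB; have [x ex xp] := wrapn_surj n (set_valP p).
  have px : realization_points K x by exists (e n).
  have := UB (Realization px) ex; rewrite /preimage /= (key (Realization px) p) // => -[_]; apply.
  by apply: contrapT => nB'; apply: nB; exists x.
move=> Up [x [ex nB'] xp]; have px : realization_points K x by exists (e n).
apply: nB'; have := UB (Realization px) ex; rewrite /preimage /= (key (Realization px) p) // => -[+ _].
exact.
Qed.

Theorem bouquet_equivalent :
  strong_equivalent R (realization R K) (countable_sphere_wedge R 2).
Proof.
pose sec (w : W) := projT1 (cid (collapse_surj w)).
have secP w : collapse_map (sec w) = w by exact: (projT2 (cid (collapse_surj w))).
have Hfib (x y : realization R K) t : collapse_map x = collapse_map y ->
    collapse_map (H (x, t)) = collapse_map (H (y, t)).
  case/collapse_fiber => [->//|[i [j [px py]]]].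
  have [k pk] := H_stage t px; have [l pl] := H_stage t py.
  by rewrite (collapse_stage pk) (collapse_stage pl).
have H1fib (x y : realization R K) : collapse_map x = collapse_map y -> H (x, 1) = H (y, 1).
  by case/collapse_fiber => [->//|[i [j [px py]]]]; exact: H1 px py.
(* The section [sec] need not be continuous, but [g] and [G] do not depend on it: the homotopy keeps
   the union of the stages inside itself and ends constant there. *)
pose g (w : W) := H (sec w, 1).
pose G (p : W * R) := collapse_map (H (sec p.1, p.2)).
have gq (x : realization R K) : g (collapse_map x) = H (x, 1) by apply: H1fib; rewrite secP.
have cH1 : continuous (fun x : realization R K => H (x, 1)).
  apply: (continuous_funcomp H_continuous).
  by apply: continuous_pair2; [move=> x; exact: cvg_id|exact: cst_continuous].
have cg : continuous g.
  apply/continuousP => U oU; apply: collapse_quotient.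
  rewrite (_ : _ @^-1` _ = (fun x : realization R K => H (x, 1)) @^-1` U).
    by move/continuousP: cH1; exact.
  by apply/seteqP; split => x /=; rewrite gq.
have cG : continuous G.
  apply: (@continuous_final_prod R unit (fun=> realization R K) _ _ (fun=> collapse_map)).
  - by move=> U oU; apply: collapse_quotient; exact: oU tt.
  - by move=> w; exists tt, (sec w).
  move=> _; rewrite (_ : (fun _ => _) = fun p => collapse_map (H p)).
    exact: continuous_funcomp collapse_continuous H_continuous.
  by apply/funext => -[x t] /=; apply: Hfib; rewrite secP.
exists collapse_map, g; split => //.
- apply: global_homotopic_sym; exists H; split => // x.
  by rewrite /= gq.
- apply: global_homotopic_sym; exists G; split => // w.
  by rewrite /G /= H0 secP.
Qed.

End bouquet.

(** * Graphs without large star forests *)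

Definition ed (i j : nat) : {fset nat} := [fset i; j]%fset.

Lemma edE i j k l :
  (ed i j == ed k l) = ((i == k) && (j == l)) || ((i == l) && (j == k)).
Proof.
apply/eqP/idP => [/fsetP E|].
  have := E i; have := E j; have := E k; have := E l.
  by rewrite !inE !eqxx ?orbT /=; lia.
by case/orP => /andP[/eqP -> /eqP ->] //; rewrite /ed fsetUC.
Qed.

Lemma edC i j : ed i j = ed j i.
Proof. by rewrite /ed fsetUC. Qed.

Definition edge_set (s : {fset {fset nat}}) : Prop :=
  forall e, e \in s -> exists i j, [/\ (0 < i)%N, (i < j)%N & e = ed i j].

(* Edges as below exist iff the complement of [{u1, u2, u3}], a set of [n - 3]
   vertices, is dominating. *)
Definition star_free (s : {fset {fset nat}}) : Prop :=
  forall u1 u2 u3 w1 w2 w3, uniq [:: u1; u2; u3] ->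
  all (fun w => w \notin [:: u1; u2; u3]) [:: w1; w2; w3] ->
  ed u1 w1 \in s -> ed u2 w2 \in s -> ed u3 w3 \in s -> False.

Lemma card_vertices n : #|` vertices n| = n.
Proof.
by rewrite /vertices card_fseq undup_id ?iota_uniq // size_iota.
Qed.

Lemma graph_on_edge n s i j : graph_on n s -> ed i j \in s ->
  [/\ (0 < i <= n)%N, (0 < j <= n)%N & i != j].
Proof.
move=> /allP gs /gs /andP[/fsubsetP sub]; rewrite cardfs2 eqSS eqb1 => ->.
by split=> //; rewrite -mem_vertices; apply: sub; rewrite !inE eqxx ?orbT.
Qed.

Lemma D2_star_free s : simplices D2 s -> edge_set s /\ star_free s.
Proof.
move=> [n /= n3 [gs s0 ds]]; split.
  move=> e es; have /andP[/fsubsetP sub /eqP/cardfs2_ex[i [j [ij E]]]] := allP gs _ es.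
  have hi : (0 < i <= n)%N by rewrite -mem_vertices; apply: sub; rewrite E !inE eqxx.
  have hj : (0 < j <= n)%N by rewrite -mem_vertices; apply: sub; rewrite E !inE eqxx orbT.
  have [lij|lji|eij] := ltngtP i j; last by rewrite eij eqxx in ij.
    by exists i, j; split; [lia|lia|exact: E].
  by exists j, i; rewrite edC; split; [lia|lia|exact: E].
move=> u1 u2 u3 w1 w2 w3 uu ww h1 h2 h3.
have [a1 b1 _] := graph_on_edge gs h1; have [a2 b2 _] := graph_on_edge gs h2.
have [a3 b3 _] := graph_on_edge gs h3.
pose U := [fset u1; u2; u3]%fset.
have U3 : #|` U| = 3%N.
  rewrite /U fsetUC cardfsU1 cardfs2 !inE.
  by move: uu; rewrite /= !inE; lia.
have Un : (U `<=` vertices n)%fset.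
  by apply/fsubsetP => v; rewrite mem_vertices !inE -orbA => /or3P[] /eqP ->.
have Dn : dominates n s (vertices n `\` U)%fset.
  rewrite /dominates fsubsetDl; apply/allP => x.
  rewrite in_fsetD in_fsetD negb_and negbK => /andP[/orP[|/negbTE ->//] xU xn].
  have wD w : (0 < w <= n)%N -> w \notin [:: u1; u2; u3] -> w \in (vertices n `\` U)%fset.
    by move=> wn; rewrite in_fsetD mem_vertices wn andbT !inE -orbA.
  move: ww => /= /and4P[ww1 ww2 ww3 _].
  move: xU; rewrite !inE -orbA => /or3P[] /eqP ->; apply/hasP.
  - by exists w1 => //; exact: wD.
  - by exists w2 => //; exact: wD.
  - by exists w3 => //; exact: wD.
move: ds; rewrite /domination_number; case: ex_minnP => m _ mmin.
have : (m <= #|` (vertices n `\` U)%fset|)%N.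
  by apply: mmin; apply/hasP; exists (vertices n `\` U)%fset; rewrite ?fpowersetE ?fsubsetDl ?Dn ?eqxx.
rewrite cardfsD (fsetIidPr Un) card_vertices U3; lia.
Qed.

Lemma star_free_D2 s : s != fset0 -> edge_set s -> star_free s -> simplices D2 s.
Proof.
move=> s0 es fs.
(* Star-freeness does not mention [n], so any [n] that is at least 3 and bounds the labels will
   do. *)
have [n [n3 gs]] : exists n, (3 <= n)%N /\ graph_on n s.
  suff: forall l : seq {fset nat}, (forall e, e \in l ->
      exists i j, [/\ (0 < i)%N, (i < j)%N & e = ed i j]) ->
      exists n, (3 <= n)%N /\ all (fun e : {fset nat} => (e `<=` vertices n)%fset && (#|` e| == 2)%N) l.
    by move=> /(_ (enum_fset s) es).
  elim=> [|e l IH] hl; first by exists 3.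
  have [|n [n3 an]] := IH; first by move=> f fl; apply: hl; rewrite inE fl orbT.
  have [|i [j [i0 ij ->]]] := hl e; first by rewrite inE eqxx.
  exists (maxn n j); split; first by lia.
  rewrite /= cardfs2; apply/andP; split.
    apply/andP; split; last by lia.
    by apply/fsubsetP => v; rewrite mem_vertices !inE => /orP[] /eqP ->; lia.
  apply: sub_all an => f /andP[/fsubsetP fn ->]; rewrite andbT.
  by apply/fsubsetP => v /fn; rewrite !mem_vertices; lia.
exists n => //; split => //.
rewrite /domination_number; case: ex_minnP => m /hasP[D _ /andP[/andP[Dn /allP dD] /eqP Dm]] _.
rewrite leqNgt; apply/negP => mn.
(* A dominating set with fewer than n - 2 vertices leaves out at least three, and these with their
   neighbours in [D] violate star-freeness. *)
pose U := (vertices n `\` D)%fset.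
have cU : (2 < #|` U|)%N by rewrite cardfsD (fsetIidPr Dn) card_vertices Dm; lia.
have cU1 : (2 < size (enum_fset U))%N by [].
have uU : uniq (enum_fset U) by exact: fset_uniq.
have mU v : v \in enum_fset U -> exists2 w, w \notin U & ed v w \in s.
  move=> vU; have /hasP[w wD vw] := dD v vU; exists w => //.
  by rewrite in_fsetD wD.
move: cU1 uU mU; have EU v : (v \in U) = (v \in enum_fset U) by [].
case: (enum_fset U) EU => [|u1 [|u2 [|u3 l]]] // EU _ uU mU.
have [w1 w1U h1] := mU u1 ltac:(by rewrite !inE eqxx).
have [w2 w2U h2] := mU u2 ltac:(by rewrite !inE eqxx ?orbT).
have [w3 w3U h3] := mU u3 ltac:(by rewrite !inE eqxx ?orbT).
apply: (fs u1 u2 u3 w1 w2 w3) => //.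
  by move: uU; rewrite /= !inE !negb_or => /and4P[/and3P[-> -> _] /andP[-> _] _ _].
move: w1U w2U w3U; rewrite !EU /= !inE !negb_or.
by move=> /and4P[-> -> -> _] /and4P[-> -> -> _] /and4P[-> -> -> _].
Qed.

Lemma edP i j k l : ed i j = ed k l -> (i = k /\ j = l) \/ (i = l /\ j = k).
Proof.
by move/eqP; rewrite edE => /orP[] /andP[/eqP -> /eqP ->]; [left|right].
Qed.

(** Three leaves and a centre would be four distinct vertices. *)
Lemma star_free_triangle a b c : star_free [fset ed a b; ed b c; ed a c]%fset.
Proof.
move=> u1 u2 u3 w1 w2 w3 uu /= /and4P[ww1 _ _ _] h1 h2 h3.
have X u w : ed u w \in [fset ed a b; ed b c; ed a c]%fset ->
    u \in [:: a; b; c] /\ w \in [:: a; b; c].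
  by rewrite !inE -!orbA => /or3P[] /eqP/edP[] [-> ->]; rewrite !eqxx ?orbT.
have [u1X w1X] := X _ _ h1; have [u2X _] := X _ _ h2; have [u3X _] := X _ _ h3.
have uX : uniq [:: w1; u1; u2; u3] by rewrite cons_uniq ww1.
have sX : {subset [:: w1; u1; u2; u3] <= [:: a; b; c]}.
  by apply/allP; rewrite /= w1X u1X u2X u3X.
by have := uniq_leq_size uX sX.
Qed.

Lemma square_diagonals a b c d : uniq [:: a; b; c; d] ->
  [/\ ed c a \notin [fset ed a b; ed b c; ed c d; ed d a]%fset,
      ed d b \notin [fset ed a b; ed b c; ed c d; ed d a]%fset,
      ed a c \notin [fset ed a b; ed b c; ed c d; ed d a]%fset &
      ed b d \notin [fset ed a b; ed b c; ed c d; ed d a]%fset].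
Proof. by rewrite /= !inE !edE; split; lia. Qed.

(** Three leaves and a centre exhaust the four vertices, so there is a single centre, adjacent to
    all the others; but no vertex of the cycle is adjacent to the opposite one. *)
Lemma star_free_square a b c d :
  uniq [:: a; b; c; d] -> star_free [fset ed a b; ed b c; ed c d; ed d a]%fset.
Proof.
move=> h u1 u2 u3 w1 w2 w3 uu /= /and4P[ww1 ww2 ww3 _] h1 h2 h3.
pose X := [:: a; b; c; d].
have inX u w : ed u w \in [fset ed a b; ed b c; ed c d; ed d a]%fset ->
    u \in X /\ w \in X.
  by rewrite /X !inE -!orbA => /or4P[] /eqP /edP[] [-> ->]; rewrite !eqxx ?orbT.
have [u1X w1X] := inX _ _ h1; have [u2X w2X] := inX _ _ h2; have [u3X w3X] := inX _ _ h3.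
have uX : uniq [:: w1; u1; u2; u3] by rewrite cons_uniq ww1.
have sX : {subset [:: w1; u1; u2; u3] <= X}.
  by apply/allP; rewrite /= w1X u1X u2X u3X.
have [_ EX] := uniq_min_size uX sX (leqnn 4).
have E w : w \in X -> w \notin [:: u1; u2; u3] -> w = w1.
  by rewrite -EX [_ \in _ :: _]inE => /orP[/eqP|->].
rewrite (E w2 w2X ww2) in h2; rewrite (E w3 w3X ww3) in h3.
have adj x : x \in X -> x != w1 -> ed x w1 \in [fset ed a b; ed b c; ed c d; ed d a]%fset.
  rewrite -EX in_cons => /orP[/eqP ->|]; first by rewrite eqxx.
  by rewrite !in_cons in_nil orbF => /or3P[] /eqP -> _.
have opp x : x \in X -> x != w1 ->
    ed x w1 \notin [fset ed a b; ed b c; ed c d; ed d a]%fset -> False.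
  by move=> xX xw /negP; apply; exact: adj.
have [ca db ac bd] := square_diagonals h.
move: h; rewrite /= !inE !negb_or => /and4P[/and3P[_ h13 _] /andP[_ h24] _ _].
move: w1X opp; rewrite !inE => /or4P[] /eqP -> opp.
- by apply: (opp c) => //; rewrite ?inE ?eqxx ?orbT // eq_sym.
- by apply: (opp d) => //; rewrite ?inE ?eqxx ?orbT // eq_sym.
- by apply: (opp a) => //; rewrite ?inE ?eqxx ?orbT.
- by apply: (opp b) => //; rewrite ?inE ?eqxx ?orbT.
Qed.

Ltac distinct := rewrite /= ?inE ?negb_or; repeat (apply/andP; split);
  solve [done | assumption | rewrite eq_sym; assumption].

Lemma star_freeP s u1 u2 u3 w1 w2 w3 : star_free s ->
  ed u1 w1 \in s -> ed u2 w2 \in s -> ed u3 w3 \in s ->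
  [&& u1 != u2, u1 != u3 & u2 != u3] ->
  [&& w1 != u1, w1 != u2 & w1 != u3] -> [&& w2 != u1, w2 != u2 & w2 != u3] ->
  [&& w3 != u1, w3 != u2 & w3 != u3] -> False.
Proof.
move=> fs h1 h2 h3 /and3P[a b c] d e f; apply: (fs u1 u2 u3 w1 w2 w3) => //=.
  by rewrite !inE negb_or a b c.
by rewrite !inE !negb_or d e f.
Qed.

Lemma uniq4P (T : eqType) (a b c d : T) : uniq [:: a; b; c; d] ->
  [/\ a != b, a != c & a != d] /\ [/\ b != c, b != d & c != d].
Proof.
by rewrite /= !inE !negb_or => /and4P[/and3P[-> -> ->] /andP[-> ->] -> _].
Qed.

(** Given an edge to a new vertex [q], wherever it starts, [q] and two vertices of the path are the
    leaves of a star forest with three edges. *)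
Lemma path_outside s a b c d p q : star_free s -> uniq [:: a; b; c; d] ->
  ed a b \in s -> ed b c \in s -> ed c d \in s -> ed p q \in s -> p != q ->
  q \in [:: a; b; c; d].
Proof.
move=> fs uu ab bc cd pqs pq; apply/negPn/negP => qn.
have ba : ed b a \in s by rewrite edC.
have cb : ed c b \in s by rewrite edC.
have dc : ed d c \in s by rewrite edC.
have qp : ed q p \in s by rewrite edC.
have [[n1 n2 n3] [n4 n5 n6]] := uniq4P uu.
move: qn; rewrite !inE !negb_or => /and4P[m1 m2 m3 m4].
have [E|pa] := eqVneq p a.
  by rewrite E in qp pq; apply: (@star_freeP s q b d a a c) => //; distinct.
have [E|pb] := eqVneq p b.
  by rewrite E in qp pq; apply: (@star_freeP s q a c b b b) => //; distinct.
have [E|pc] := eqVneq p c.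
  by rewrite E in qp pq; apply: (@star_freeP s q b d c c c) => //; distinct.
have [E|pd] := eqVneq p d.
  by rewrite E in qp pq; apply: (@star_freeP s q c a d d b) => //; distinct.
by apply: (@star_freeP s q a c p b b) => //; distinct.
Qed.

(** No edge leaves the path, and a diagonal would make [b] or [c] the centre of three edges; only
    the edge closing the 4-cycle can be added. *)
Lemma path_extend s a b c d p q : star_free s -> uniq [:: a; b; c; d] ->
  ed a b \in s -> ed b c \in s -> ed c d \in s -> ed p q \in s -> p != q ->
  ed p q \in [fset ed a b; ed b c; ed c d; ed d a]%fset.
Proof.
move=> fs uu ab bc cd pqs pq.
have qX := path_outside fs uu ab bc cd pqs pq.
have pX : p \in [:: a; b; c; d].
  by apply: (@path_outside s a b c d q p) => //; rewrite 1?edC // eq_sym.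
have [[n1 n2 n3] [n4 n5 n6]] := uniq4P uu.
have noac : ed a c \notin s.
  apply/negP => ac; have dc : ed d c \in s by rewrite edC.
  by apply: (@star_freeP s a b d c c c) => //; distinct.
have nobd : ed b d \notin s.
  apply/negP => bd; have cb : ed c b \in s by rewrite edC.
  have db : ed d b \in s by rewrite edC.
 
  by apply: (@star_freeP s a c d b b b) => //; distinct.
move: pX qX pqs pq; rewrite !inE => /or4P[] /eqP -> /or4P[] /eqP -> pqs;
  rewrite ?eqxx //= => _; rewrite !edE !eqxx ?orbT //.
all: by move: pqs; rewrite ?(edC c a) ?(edC d b) ?(negbTE noac) ?(negbTE nobd).
Qed.

(** Three pairwise disjoint edges are a star forest, so two edges meet. An edge outside the triangle
    on these two, which exists among four edges, prolongs them to a path or yields a star forest. *)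
Lemma find_path s : edge_set s -> star_free s -> (3 < #|` s|)%N ->
  exists a b c d, [/\ uniq [:: a; b; c; d], ed a b \in s, ed b c \in s & ed c d \in s].
Proof.
move=> es fs s4.
have ednn p q : ed p q \in s -> p != q.
  move=> /es [i [j [_ ij /edP[] [-> ->]]]]; lia.
have pick (t : {fset {fset nat}}) : (#|` t| <= 3)%N -> exists p q, ed p q \in s /\ ed p q \notin t.
  move=> t3; have [e ews] : exists e, e \in (s `\` t)%fset.
    apply/fset0Pn; rewrite -cardfs_gt0 cardfsD subn_gt0.
    by apply: leq_ltn_trans s4; apply: leq_trans t3; apply: fsubset_leq_card; exact: fsubsetIr.
  move: ews; rewrite in_fsetD => /andP[et ess].
  by have [i [j [_ _ E]]] := es e ess; exists i, j; rewrite -E.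
have adj a b c : ed a b \in s -> ed b c \in s -> a != c ->
    exists a b c d, [/\ uniq [:: a; b; c; d], ed a b \in s, ed b c \in s & ed c d \in s].
  move=> ab bc ac; have nab := ednn _ _ ab; have nbc := ednn _ _ bc.
  have cb : ed c b \in s by rewrite edC.
  have step p q : ed p q \in s -> q \notin [:: a; b; c] ->
    exists a b c d, [/\ uniq [:: a; b; c; d], ed a b \in s, ed b c \in s & ed c d \in s].
    rewrite !inE !negb_or => pqs /and3P[qa qb qc]; have qps : ed q p \in s by rewrite edC.
    have npq := ednn _ _ pqs.
    have [E|pa] := eqVneq p a.
      by rewrite E in qps npq; exists q, a, b, c; split => //; distinct.
    have [E|pc] := eqVneq p c.
      by rewrite E in pqs npq; exists a, b, c, q; split => //; distinct.
    by exfalso; apply: (@star_freeP s q a c p b b) => //; distinct.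
  have [|p [q [pqs]]] := pick [fset ed a b; ed b c; ed a c]%fset.
    by rewrite fsetUC cardfsU1 cardfs2; case: (_ \notin _); case: (_ != _).
  rewrite !inE !edE => pqn; have npq := ednn _ _ pqs.
  have [qn|qn] := boolP (q \in [:: a; b; c]); last exact: step pqs qn.
  have [pn|pn] := boolP (p \in [:: a; b; c]); last by apply: (step q p) => //; rewrite edC.
  by exfalso; move: qn pn; rewrite !inE; lia.
have [|a [b [ab _]]] := pick fset0; first by rewrite cardfs0.
have nab := ednn _ _ ab; have ba : ed b a \in s by rewrite edC.
have [|c [d [cd]]] := pick [fset ed a b]%fset; first by rewrite cardfs1.
rewrite in_fset1 => cdn; have ncd := ednn _ _ cd; have dc : ed d c \in s by rewrite edC.
have [|p [q [pqs]]] := pick [fset ed a b; ed c d]%fset; first by rewrite cardfs2; case: (_ != _).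
rewrite !inE negb_or => /andP[pq1 pq2]; have npq := ednn _ _ pqs; have qps : ed q p \in s by rewrite edC.
have meet x y z w : ed x y \in s -> ed y x \in s -> ed z w \in s -> ed w z \in s -> ed z w != ed x y ->
    [|| x == z, x == w, y == z | y == w] ->
    exists a b c d, [/\ uniq [:: a; b; c; d], ed a b \in s, ed b c \in s & ed c d \in s].
  move=> xy yx zw wz ne /or4P[] /eqP E.
  - by rewrite -E in zw ne; apply: (adj y x w) => //; apply: contraNneq ne => ->.
  - by rewrite -E in wz ne; apply: (adj y x z) => //; apply: contraNneq ne => ->; rewrite edC.
  - by rewrite -E in zw ne; apply: (adj x y w) => //; apply: contraNneq ne => ->; rewrite edC.
  - by rewrite -E in wz ne; apply: (adj x y z) => //; apply: contraNneq ne => ->.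
have [h|h1] := boolP [|| a == c, a == d, b == c | b == d].
  by apply: (meet a b c d) .
have [h|h2] := boolP [|| a == p, a == q, b == p | b == q].
  by apply: (meet a b p q).
have [h|h3] := boolP [|| c == p, c == q, d == p | d == q].
  by apply: (meet c d p q).
move: h1 h2 h3; rewrite !negb_or => /and4P[? ? ? ?] /and4P[? ? ? ?] /and4P[? ? ? ?].
by exfalso; apply: (@star_freeP s a c p b d q) => //; distinct.
Qed.

(* The free faces [sg] and opposite vertices [a] of the tetrahedra of [D2], which
   are the 4-cycles k-i-N-j with largest label [N]. *)
Definition square_face (sg : {fset {fset nat}}) (a : {fset nat}) : Prop :=
  exists k i N j, [/\ [&& (0 < j)%N, (j < i)%N, (i < N)%N, (0 < k)%N & (k < N)%N],
    k != i, k != j, sg = [fset ed k i; ed i N; ed N j]%fset & a = ed j k].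

Lemma edge_set_ed i j : (0 < i)%N -> (0 < j)%N -> i != j ->
  exists k l, [/\ (0 < k)%N, (k < l)%N & ed i j = ed k l].
Proof.
move=> i0 j0 ij; have [lt|lt|eq] := ltngtP i j.
- by exists i, j.
- by exists j, i; rewrite edC.
- by rewrite eq eqxx in ij.
Qed.

Lemma square_faceE k i N j : (ed j k |` [fset ed k i; ed i N; ed N j])%fset =
  [fset ed k i; ed i N; ed N j; ed j k]%fset.
Proof. by rewrite fsetUC. Qed.

Lemma square_D2 a b c d : uniq [:: a; b; c; d] -> (0 < a)%N -> (0 < b)%N ->
  (0 < c)%N -> (0 < d)%N -> simplices D2 [fset ed a b; ed b c; ed c d; ed d a]%fset.
Proof.
move=> uu a0 b0 c0 d0; apply: star_free_D2; last exact: star_free_square.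
  by apply/fset0Pn; exists (ed a b); rewrite !inE eqxx.
have [[ab ac ad] [bc bd cd]] := uniq4P uu.
move=> e; rewrite !inE -!orbA => /or4P[] /eqP ->; apply: edge_set_ed => //.
by rewrite eq_sym.
Qed.

Lemma triangle_D2 a b c : a != b -> a != c -> b != c -> (0 < a)%N -> (0 < b)%N ->
  (0 < c)%N -> simplices D2 [fset ed a b; ed b c; ed a c]%fset.
Proof.
move=> ab ac bc a0 b0 c0; apply: star_free_D2; last exact: star_free_triangle.
  by apply/fset0Pn; exists (ed a b); rewrite !inE eqxx.
by move=> e; rewrite !inE -!orbA => /or3P[] /eqP ->; apply: edge_set_ed.
Qed.

Lemma square_face_simplex sg a : square_face sg a ->
  [/\ a \notin sg, sg != fset0 & simplices D2 (a |` sg)%fset].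
Proof.
move=> [k [i [N [j [h ki kj -> ->]]]]]; split.
- by rewrite !inE !edE; lia.
- by apply/fset0Pn; exists (ed k i); rewrite !inE eqxx.
- rewrite square_faceE; apply: square_D2; rewrite /= ?inE; lia.
Qed.

Lemma square_face_free sg a s : square_face sg a -> simplices D2 s ->
  (sg `<=` s)%fset -> (s `<=` a |` sg)%fset.
Proof.
move=> [k [i [N [j [h ki kj -> ->]]]]] /D2_star_free[es fs] /fsubsetP sub.
rewrite square_faceE; apply/fsubsetP => e ess; have [p [q [_ pq E]]] := es e ess.
rewrite E in ess *; apply: (path_extend fs) => //.
- by rewrite /= !inE; lia.
- by apply: sub; rewrite !inE eqxx.
- by apply: sub; rewrite !inE eqxx orbT.
- by apply: sub; rewrite !inE eqxx orbT.
- by rewrite neq_ltn pq.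
Qed.

(** The labelling is read off the cycle: [N] is its largest vertex, [i] and [j] are the larger and
    the smaller neighbour of [N], and [k] is opposite to [N]. *)
Lemma square_face_uniq sg a sg' a' : square_face sg a -> square_face sg' a' ->
  (sg' `<=` a |` sg)%fset -> sg' = sg /\ a' = a.
Proof.
move=> [k [i [N [j [h ki kj -> ->]]]]] [k' [i' [N' [j' [h' ki' kj' -> ->]]]]].
rewrite square_faceE => /fsubsetP sub.
have h1 : ed i' N' \in [fset ed k i; ed i N; ed N j; ed j k]%fset.
  by apply: sub; rewrite !inE eqxx orbT.
have h2 : ed N' j' \in [fset ed k i; ed i N; ed N j; ed j k]%fset.
  by apply: sub; rewrite !inE eqxx orbT.
have h3 : ed k' i' \in [fset ed k i; ed i N; ed N j; ed j k]%fset.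
  by apply: sub; rewrite !inE eqxx.
suff [-> -> -> ->] : [/\ k' = k, i' = i, N' = N & j' = j] by [].
move: h1 h2 h3 {sub}; rewrite !inE -!orbA => /or4P[] /eqP/edP[] [? ?] /or4P[] /eqP/edP[] [? ?];
  try (exfalso; lia); move=> /or4P[] /eqP/edP[] [? ?]; split; lia.
Qed.

Lemma square_face_card s : simplices D2 s -> (3 < #|` s|)%N ->
  exists sg a, square_face sg a /\ (sg `<=` s)%fset.
Proof.
move=> /[dup] Ks /D2_star_free[es fs] s4.
have [a [b [c [d [uu ab bc cd]]]]] := find_path es fs s4.
have ssq : (s `<=` [fset ed a b; ed b c; ed c d; ed d a])%fset.
  apply/fsubsetP => e ess; have [p [q [_ pq E]]] := es e ess.
  by rewrite E in ess *; apply: (path_extend fs) => //; rewrite neq_ltn pq.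
have da : ed d a \in s.
  apply/negPn/negP => nda; move: s4; rewrite ltnNge => /negP; apply.
  have sub : (s `<=` [fset ed a b; ed b c; ed c d])%fset.
    apply/fsubsetP => e ess; have := fsubsetP ssq e ess.
    by rewrite in_fsetU in_fset1 => /orP[//|/eqP E]; rewrite -E ess in nda.
  apply: leq_trans (fsubset_leq_card sub) _.
  by rewrite fsetUC cardfsU1 cardfs2; case: (_ \notin _); case: (_ != _).
have [a0 b0 c0 d0] : [/\ (0 < a)%N, (0 < b)%N, (0 < c)%N & (0 < d)%N].
  have pos p q : ed p q \in s -> (0 < p)%N /\ (0 < q)%N.
    by move=> /es [i [j [i0 ij /edP[] [-> ->]]]]; split; lia.
  by have [? ?] := pos _ _ ab; have [? ?] := pos _ _ cd.
(* The cycle is rotated to put its largest label at [N], and reversed if needed to get [j < i]. *)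
have cyc k i N j : uniq [:: k; i; N; j] -> ed k i \in s -> ed i N \in s ->
    ed N j \in s -> ed j k \in s -> (0 < k)%N -> (0 < i)%N -> (0 < j)%N ->
    (k < N)%N -> (i < N)%N -> (j < N)%N ->
    exists sg a, square_face sg a /\ (sg `<=` s)%fset.
  move=> u ki iN Nj jk k0 i0 j0 kN lN jN.
  have [[k1 k2 k3] [i1 i2 i3]] := uniq4P u.
  have [lt|lt|E] := ltngtP j i; last by rewrite E eqxx in i2.
    exists [fset ed k i; ed i N; ed N j]%fset, (ed j k); split.
      by exists k, i, N, j; split => //; lia.
    by apply/fsubsetP => e; rewrite !inE -orbA => /or3P[] /eqP ->.
  exists [fset ed k j; ed j N; ed N i]%fset, (ed i k); split.
    by exists k, j, N, i; split => //; lia.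
  by apply/fsubsetP => e; rewrite !inE -orbA => /or3P[] /eqP ->; rewrite edC.
have [[n1 n2 n3] [n4 n5 n6]] := uniq4P uu.
have [/and3P[? ? ?]|] := boolP [&& b < a, c < a & d < a]%N.
  by apply: (cyc c d a b) => //; distinct.
have [/and3P[? ? ?] _|] := boolP [&& a < b, c < b & d < b]%N.
  by apply: (cyc d a b c) => //; distinct.
have [/and3P[? ? ?] _ _|] := boolP [&& a < c, b < c & d < c]%N.
  by apply: (cyc a b c d) => //; distinct.
move=> h1 h2 h3; have [? ? ?] : [/\ a < d, b < d & c < d]%N by split; lia.
by apply: (cyc b c d a) => //; distinct.
Qed.

(** * The contractible subcomplex *)

Definition squareless : simplicial_complex {fset nat} :=
  collapsed D2 square_face.

(** The least positive label other than [i], so that the root {hub i, i} is the first edge at [i] in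
    the order below. *)
Definition hub (i : nat) : nat := if i == 1%N then 2%N else 1%N.

(* Order the edges by largest, then by smallest endpoint. The link of the vertex
   iN of [squareless] among the earlier vertices is a connected graph, and
   [parent i N d p q r s] describes a spanning tree of it with root {hub i, i}:
   the vertex pq is at depth at most [d], and rs is its parent. *)
Definition parent (i N d p q r s : nat) : Prop :=
  [\/ [/\ d = 1%N, p = hub i, r = hub i, s = i &
        [&& (0 < q)%N, (q < N)%N, q != i & q != hub i]],
      [/\ d = 2%N, p = i, r = hub i, s = q &
        [&& (0 < q)%N, (q < N)%N, q != i & q != hub i]],
      [/\ d = 3%N, r = i, s = p, [&& (0 < p)%N, (p < q)%N & (q < N)%N] &
        [&& p != i, p != hub i, q != i & q != hub i]] |
      [/\ d = 3%N, q = N, r = i, s = p & (0 < p < i)%N]].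

(** As [i < N], the number [N * N + i] orders the edges as prescribed; the factor 4 leaves room for
    the root and the depths 1 to 3. *)
Definition rank (i N : nat) : nat := 4 * (N * N + i).

(** The vertex [ed i N] enters as the free end of its edge to the root. Each further edge, from
    [ed i N] to [ed p q], is a free face of the triangle over the tree edge from [ed p q] to its
    parent. The condition [2 < N] leaves out the base point [ed 1 2]. *)
Definition tree_face (k : nat) (sg : {fset {fset nat}}) (a : {fset nat}) : Prop :=
  exists i N, [/\ (0 < i)%N, (i < N)%N, (2 < N)%N &
    [/\ k = rank i N, sg = [fset ed i N]%fset & a = ed (hub i) i] \/
    exists d p q r s, [/\ parent i N d p q r s, k = (rank i N + d)%N,
      sg = [fset ed i N; ed p q]%fset & a = ed r s]].

Definition below (i N : nat) (e : {fset nat}) : Prop := exists p q,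
  [/\ (0 < p)%N, (p < q)%N, ((q < N) || ((q == N) && (p < i)))%N & e = ed p q].

Lemma hubP i : (0 < i)%N -> [/\ (0 < hub i)%N, (hub i <= 2)%N & hub i != i].
Proof. by rewrite /hub; case: eqP => /= h ?; split => //; lia. Qed.

Lemma belowN i N p q : (0 < p)%N -> (0 < q)%N -> p != q -> (p < N)%N -> (q < N)%N ->
  below i N (ed p q).
Proof.
move=> p0 q0 pq pN qN; have [lt|lt|E] := ltngtP p q; last by rewrite E eqxx in pq.
  by exists p, q; rewrite qN.
by exists q, p; rewrite pN edC.
Qed.

Lemma parent_below i N d p q r s : (0 < i)%N -> (i < N)%N -> (2 < N)%N ->
  parent i N d p q r s -> below i N (ed p q) /\ below i N (ed r s).
Proof.
move=> i0 iN N2; have [b0 b2 bi] := hubP i0.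
case=> [[_ -> -> -> /and4P[? ? ? ?]]|[_ -> -> -> /and4P[? ? ? ?]]|
  [_ -> -> /and3P[? ? ?] /and4P[? ? ? ?]]|[_ -> -> -> /andP[? ?]]].
- by split; apply: belowN => //; lia.
- by split; apply: belowN => //; lia.
- by split; apply: belowN => //; lia.
- split; last by apply: belowN => //; lia.
  by exists p, N; split => //; lia.
Qed.

Lemma rank_below i N p q : (p < q)%N -> ((q < N) || ((q == N) && (p < i)))%N ->
  (rank p q + 4 <= rank i N)%N.
Proof. by rewrite /rank; nia. Qed.

Local Notation tree_stage := (stage (ed 1 2) tree_face).

Lemma stage_vertex p q k : (0 < p)%N -> (p < q)%N -> (rank p q < k)%N ->
  tree_stage k [fset ed p q]%fset.
Proof.
move=> p0 pq rk; have [q2|q2] := leqP q 2.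
  by left; congr [fset ed _ _]%fset; lia.
right; exists (rank p q), [fset ed p q]%fset, (ed (hub p) p); split => //; last by left.
by exists p, q; split => //; left.
Qed.

Lemma stage_root i N k : (0 < i)%N -> (i < N)%N -> (2 < N)%N -> (rank i N < k)%N ->
  tree_stage k [fset ed (hub i) i; ed i N]%fset.
Proof.
move=> i0 iN N2 rk.
right; exists (rank i N), [fset ed i N]%fset, (ed (hub i) i); split => //; last by right.
by exists i, N; split => //; left.
Qed.

Lemma stage_parent i N d p q r s k : (0 < i)%N -> (i < N)%N -> (2 < N)%N ->
  parent i N d p q r s -> (rank i N + d < k)%N ->
  tree_stage k [fset ed i N; ed p q]%fset.
Proof.
move=> i0 iN N2 par rk.
right; exists (rank i N + d)%N, [fset ed i N; ed p q]%fset, (ed r s); split => //.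
  by exists i, N; split => //; right; exists d, p, q, r, s.
by left.
Qed.

Lemma below_tree i N e : (0 < i)%N -> (i < N)%N -> below i N e ->
  (2 < N)%N /\ (e = ed (hub i) i \/ exists d p q r s, e = ed p q /\ parent i N d p q r s).
Proof.
move=> i0 iN [p [q [p0 pq h ->]]]; have N2 : (2 < N)%N by lia.
split => //; have [b0 b2 bi] := hubP i0.
move: h => /orP[qN|/andP[/eqP -> pi]]; last first.
  by right; exists 3%N, p, N, i, p; split => //; constructor 4; split => //; rewrite p0.
have [E|pb] := eqVneq p (hub i).
  have [E'|qi] := eqVneq q i; first by left; rewrite E E'.
  right; exists 1%N, p, q, (hub i), i; split => //; constructor 1; split => //.
  by apply/and4P; split => //; lia.
have [E|qb] := eqVneq q (hub i).
  have [E'|pi] := eqVneq p i; first by left; rewrite E E' edC.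
  right; exists 1%N, q, p, (hub i), i; rewrite edC; split => //; constructor 1; split => //.
  by apply/and4P; split => //; lia.
have [E|pi] := eqVneq p i.
  right; exists 2%N, p, q, (hub i), q; split => //; constructor 2; split => //.
  by apply/and4P; split => //; lia.
have [E|qi] := eqVneq q i.
  right; exists 2%N, q, p, (hub i), p; rewrite edC; split => //; constructor 2; split => //.
  by apply/and4P; split => //; lia.
right; exists 3%N, p, q, i, p; split => //; constructor 3; split => //.
  by rewrite p0 pq.
by apply/and4P; split.
Qed.

Lemma parent_le3 i N d p q r s : parent i N d p q r s -> (0 < d <= 3)%N.
Proof. by case=> [] [->]. Qed.

Lemma stage_edge i N e k : (0 < i)%N -> (i < N)%N -> below i N e ->
  (rank i N + 3 < k)%N -> tree_stage k [fset ed i N; e]%fset.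
Proof.
move=> i0 iN be rk; have [N2 [->|[d [p [q [r [s [-> par]]]]]]]] := below_tree i0 iN be.
  by rewrite fsetUC; apply: stage_root => //; lia.
have := parent_le3 par => /andP[_ d3].
by apply: (stage_parent _ _ _ par) => //; lia.
Qed.

(** The parent is the root or has smaller depth, so its edge to [ed i N] was added before. *)
Lemma parent_up i N d p q r s k : (0 < i)%N -> (i < N)%N -> (2 < N)%N ->
  parent i N d p q r s -> (rank i N + d <= k)%N -> tree_stage k [fset ed i N; ed r s]%fset.
Proof.
move=> i0 iN N2; have [b0 b2 bi] := hubP i0.
have root : (rank i N < k)%N -> tree_stage k [fset ed i N; ed (hub i) i]%fset.
  by move=> ?; rewrite fsetUC; apply: stage_root.
case=> [[-> _ -> -> _]|[-> _ -> -> /and4P[? ? ? ?]]|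
  [-> -> -> /and3P[? ? ?] /and4P[? ? ? ?]]|[-> _ -> -> /andP[? ?]]] rk.
- by apply: root; lia.
- apply: (@stage_parent i N 1 (hub i) q (hub i) i) => //; last by lia.
  by constructor 1; split => //; apply/and4P.
- apply: (@stage_parent i N 2 i p (hub i) p) => //; last by lia.
  by constructor 2; split => //; apply/and4P; split => //; lia.
- have [->|pb] := eqVneq p (hub i); first by rewrite (edC i (hub i)); apply: root; lia.
  apply: (@stage_parent i N 2 i p (hub i) p) => //; last by lia.
  by constructor 2; split => //; apply/and4P; split => //; lia.
Qed.

(** Of two earlier vertices one precedes the other, so the edge joining them was added together with
    the later one. *)
Lemma below_trans i N e f : below i N e -> below i N f -> e != f ->
  exists p q, [/\ (0 < p)%N, (p < q)%N, (rank p q + 4 <= rank i N)%N &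
    [fset e; f]%fset = [fset ed p q; e]%fset /\ below p q e /\ f = ed p q \/
    [fset e; f]%fset = [fset ed p q; f]%fset /\ below p q f /\ e = ed p q].
Proof.
move=> [p [q [p0 pq hpq E]]] [r [s [r0 rs hrs F]]] ef.
have [lt|lt] := boolP ((q < s) || ((q == s) && (p < r)))%N.
  exists r, s; split => //; first exact: rank_below.
  left; split; first by rewrite F fsetUC.
  by split => //; exists p, q.
exists p, q; split => //; first exact: rank_below.
right; split; first by rewrite E.
split => //; exists r, s; split => //.
have : ~~ ((p == r) && (q == s)).
  by apply: contraNN ef => /andP[/eqP h1 /eqP h2]; rewrite E F h1 h2.
lia.
Qed.

Lemma fsub3 (T : choiceType) (a x v : T) t : (t `<=` a |` [fset x; v])%fset ->
  t \in [:: fset0; [fset a]; [fset x]; [fset v]; [fset a; x]; [fset a; v];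
    [fset x; v]; a |` [fset x; v]]%fset.
Proof.
move=> /fsubsetP sub.
have -> : t = [fset y in mask [:: a \in t; x \in t; v \in t] [:: a; x; v]]%fset.
  rewrite -[mask _ _]/(mask [seq y \in t | y <- [:: a; x; v]] _) -filter_mask.
  apply/fsetP => y; rewrite !inE mem_filter.
  by case: (boolP (y \in t)) => // /sub; rewrite !inE.
have norm (s1 s2 : {fset T}) : s1 = s2 -> forall l : seq {fset T}, s2 \in l -> s1 \in l by move=> ->.
case: (a \in t); case: (x \in t); case: (v \in t) => /=.
- by apply: (@norm _ (a |` [fset x; v])%fset); [apply/fsetP => y; rewrite !inE ?orbF ?orbA|rewrite !in_cons eqxx ?orbT].
- by apply: (@norm _ [fset a; x]%fset); [apply/fsetP => y; rewrite !inE ?orbF ?orbA|rewrite !in_cons eqxx ?orbT].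
- by apply: (@norm _ [fset a; v]%fset); [apply/fsetP => y; rewrite !inE ?orbF ?orbA|rewrite !in_cons eqxx ?orbT].
- by apply: (@norm _ [fset a]%fset); [apply/fsetP => y; rewrite !inE ?orbF ?orbA|rewrite !in_cons eqxx ?orbT].
- by apply: (@norm _ [fset x; v]%fset); [apply/fsetP => y; rewrite !inE ?orbF ?orbA|rewrite !in_cons eqxx ?orbT].
- by apply: (@norm _ [fset x]%fset); [apply/fsetP => y; rewrite !inE ?orbF ?orbA|rewrite !in_cons eqxx ?orbT].
- by apply: (@norm _ [fset v]%fset); [apply/fsetP => y; rewrite !inE ?orbF ?orbA|rewrite !in_cons eqxx ?orbT].
- by apply: (@norm _ fset0); [apply/fsetP => y; rewrite !inE ?orbF ?orbA|rewrite !in_cons eqxx ?orbT].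
Qed.

Lemma stage_below i N e k : below i N e -> (rank i N <= k)%N -> tree_stage k [fset e]%fset.
Proof.
move=> [p [q [p0 pq h ->]]] rk; apply: stage_vertex => //.
by have := rank_below pq h; lia.
Qed.

(** The three edges of a star forest are distinct, since a leaf is an endpoint of its own edge
    only. *)
Lemma star_free_small s : (#|` s| <= 2)%N -> star_free s.
Proof.
move=> s2 u1 u2 u3 w1 w2 w3; rewrite /= !inE => uu ww h1 h2 h3.
have ne u u' w w' : u != u' -> u != w' -> ed u w != ed u' w'.
  by move=> h h'; rewrite edE (negbTE h) (negbTE h').
move: uu ww; rewrite !negb_or => /and3P[/andP[u12 u13] u23 _].
move=> /and4P[/and3P[a1 a2 a3] /and3P[b1 b2 b3] /and3P[c1 c2 c3] _].
have : (#|` [fset ed u1 w1; ed u2 w2; ed u3 w3]| <= #|` s|)%N.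
  apply: fsubset_leq_card; apply/fsubsetP => e.
  by rewrite !inE -orbA => /or3P[] /eqP ->.
rewrite card_triangle; first by lia.
- by apply: ne; rewrite // eq_sym.
- by apply: ne; rewrite // eq_sym.
- by apply: ne; rewrite // eq_sym.
Qed.

Lemma square_face_card3 sg a : square_face sg a -> #|` sg| = 3%N.
Proof.
by move=> [k [i [N [j [h ki kj -> _]]]]]; rewrite card_triangle // edE; lia.
Qed.

Lemma squareless_small s : s != fset0 -> edge_set s -> (#|` s| <= 2)%N ->
  simplices squareless s.
Proof.
move=> s0 es s2; split.
  by apply: star_free_D2 => //; exact: star_free_small.
move=> sg a Ma; apply/negP => /fsubset_leq_card.
by rewrite (square_face_card3 Ma) => /leq_trans /(_ s2).
Qed.

Lemma below_neq i N e : (i < N)%N -> below i N e -> e != ed i N.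
Proof. by move=> iN [p [q [p0 pq h ->]]]; rewrite edE; lia. Qed.

Lemma below_label i N i' N' : (i' < N')%N -> below i N (ed i' N') -> (N' <= N)%N.
Proof. by move=> iN [p [q [p0 pq h /edP[] [? ?]]]]; lia. Qed.

Lemma parent_neq i N d p q r s : (0 < i)%N -> (i < N)%N -> parent i N d p q r s ->
  ed r s != ed p q.
Proof.
move=> i0 iN; have [b0 b2 bi] := hubP i0; rewrite edE.
case=> [[_ -> -> -> /and4P[? ? ? ?]]|[_ -> -> -> /and4P[? ? ? ?]]|
  [_ -> -> /and3P[? ? ?] /and4P[? ? ? ?]]|[_ -> -> -> /andP[? ?]]]; lia.
Qed.

(** In the first three cases the edges form a path ending at [N], part of a 4-cycle; in the last
    they form the triangle on [p], [i] and [N]. *)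
Lemma parent_D2 i N d p q r s : (0 < i)%N -> (i < N)%N -> (2 < N)%N ->
  parent i N d p q r s -> simplices D2 [fset ed r s; ed i N; ed p q]%fset.
Proof.
move=> i0 iN N2; have [b0 b2 bi] := hubP i0.
have sq a b c d' : uniq [:: a; b; c; d'] -> [&& 0 < a, 0 < b, 0 < c & 0 < d']%N ->
    forall e f g, e \in [:: ed a b; ed b c; ed c d'] -> f \in [:: ed a b; ed b c; ed c d'] ->
    g \in [:: ed a b; ed b c; ed c d'] -> simplices D2 [fset e; f; g]%fset.
  move=> u /and4P[a0 c0 d0 e0] e f g he hf hg.
  have := square_D2 u a0 c0 d0 e0; move/simplices_sub; apply.
    apply/fsubsetP => x; rewrite !inE -orbA => /or3P[] /eqP ->.
    - by move: he; rewrite !inE => /or3P[] ->; rewrite ?orbT.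
    - by move: hf; rewrite !inE => /or3P[] ->; rewrite ?orbT.
    - by move: hg; rewrite !inE => /or3P[] ->; rewrite ?orbT.
  by apply/fset0Pn; exists e; rewrite !inE eqxx.
case=> [[_ -> -> -> /and4P[? ? ? ?]]|[_ -> -> -> /and4P[? ? ? ?]]|
  [_ -> -> /and3P[? ? ?] /and4P[? ? ? ?]]|[_ -> -> -> /andP[? ?]]].
- have u : uniq [:: N; i; hub i; q] by rewrite /= !inE; lia.
  by apply: (sq _ _ _ _ u); rewrite ?inE ?edE ?eqxx ?orbT //; lia.
- have u : uniq [:: N; i; q; hub i] by rewrite /= !inE; lia.
  by apply: (sq _ _ _ _ u); rewrite ?inE ?edE ?eqxx ?orbT //; lia.
- have u : uniq [:: N; i; p; q] by rewrite /= !inE; lia.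
  by apply: (sq _ _ _ _ u); rewrite ?inE ?edE ?eqxx ?orbT //; lia.
- have := @triangle_D2 p i N; rewrite (edC p i); apply; lia.
Qed.

(** A collapsed free face is a path whose largest vertex is not an end. Here the largest vertex [N]
    is an end of the path, or the edges form a triangle. *)
Lemma tree_squareless i N d p q r s : (0 < i)%N -> (i < N)%N -> (2 < N)%N ->
  parent i N d p q r s -> simplices squareless [fset ed r s; ed i N; ed p q]%fset.
Proof.
move=> i0 iN N2 par; split; first exact: parent_D2 par.
move=> sg a Ma; apply/negP => sub; have [bpq brs] := parent_below i0 iN N2 par.
have [k' [i' [N' [j' [h ki kj E _]]]]] := Ma.
have card : (#|` [fset ed r s; ed i N; ed p q]| <= 3)%N.
  by rewrite fsetUC cardfsU1 cardfs2; case: (_ \notin _); case: (_ != _).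
have eqsg : sg = [fset ed r s; ed i N; ed p q]%fset.
  by apply/eqP; rewrite eqEfcard sub (square_face_card3 Ma).
have NN : N' = N.
  apply/eqP; rewrite eqn_leq; apply/andP; split.
    have : ed i' N' \in sg by rewrite E !inE eqxx orbT.
    rewrite eqsg !inE -orbA => /or3P[] /eqP F.
    - by apply: (@below_label i N i'); [lia|rewrite F].
    - by move/edP: F => [] [? ?]; lia.
    - by apply: (@below_label i N i'); [lia|rewrite F].
  have : ed i N \in sg by rewrite eqsg !inE eqxx orbT.
  by rewrite E !inE -orbA => /or3P[] /eqP/edP[] [? ?]; lia.
have h1 : ed i' N \in sg by rewrite E NN !inE eqxx orbT.
have h2 : ed N j' \in sg by rewrite E NN !inE eqxx orbT.
have h3 : ed k' i' \in sg by rewrite E !inE eqxx.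
have [b0 b2 bi] := hubP i0; rewrite {}NN in h; clear E.
move: h1 h2 h3; rewrite eqsg !inE -!orbA.
case: par => [[_ -> -> -> /and4P[? ? ? ?]]|[_ -> -> -> /and4P[? ? ? ?]]|
  [_ -> -> /and3P[? ? ?] /and4P[? ? ? ?]]|[_ -> -> -> /andP[? ?]]];
  move=> /or3P[] /eqP/edP[] [? ?]; try (exfalso; lia);
  move=> /or3P[] /eqP/edP[] [? ?]; try (exfalso; lia);
  move=> /or3P[] /eqP/edP[] [? ?]; lia.
Qed.

Lemma tree_face_simplex k sg a : tree_face k sg a ->
  [/\ a \notin sg, sg != fset0 & simplices squareless (a |` sg)%fset].
Proof.
move=> [i [N [i0 iN N2 [[_ -> ->]|[d [p [q [r [s [par _ -> ->]]]]]]]]]].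
  have [b0 b2 bi] := hubP i0; split.
  - by rewrite !inE edE; lia.
  - by apply/fset0Pn; exists (ed i N); rewrite inE.
  - apply: squareless_small.
    + by apply/fset0Pn; exists (ed i N); rewrite !inE eqxx orbT.
    + by move=> e; rewrite !inE => /orP[] /eqP ->; apply: edge_set_ed; lia.
    + by rewrite cardfs2; case: (_ != _).
have [bpq brs] := parent_below i0 iN N2 par; split.
- by rewrite !inE negb_or (below_neq iN brs) (parent_neq i0 iN par).
- by apply/fset0Pn; exists (ed i N); rewrite !inE eqxx.
- by rewrite fsetUA; exact: tree_squareless par.
Qed.

Lemma tree_face_face k sg a t : tree_face k sg a -> (t `<=` a |` sg)%fset ->
  t != fset0 -> t != sg -> t != (a |` sg)%fset -> tree_stage k t.
Proof.
move=> [i [N [i0 iN N2 [[-> -> ->]|[d [p [q [r [s [par -> -> ->]]]]]]]]]].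
  have [b0 b2 bi] := hubP i0.
  (* The single vertex is written as a degenerate pair, so that [fsub3] covers the root case as
     well. *)
  rewrite -{1}[[fset ed i N]%fset]fsetUid => /fsub3 + t0 tsg tt.
  rewrite fsetUid !inE (negbTE t0) (negbTE tsg) (negbTE tt) !orbF /= => /eqP ->.
  by apply: (@stage_below i N) => //; apply: belowN; lia.
have [bpq brs] := parent_below i0 iN N2 par; have /andP[d0 _] := parent_le3 par.
move=> /fsub3 + t0 tsg tt.
rewrite !inE (negbTE t0) (negbTE tsg) (negbTE tt) !orbF /=.
move=> /or4P[/eqP ->|/eqP ->|/eqP ->|/orP[/eqP ->|/eqP ->]].
- by apply: (@stage_below i N) => //; lia.
- by apply: stage_vertex => //; lia.
- by apply: (@stage_below i N) => //; lia.
- by rewrite fsetUC; apply: (parent_up i0 iN N2 par).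
have [p' [q' [p0 pq rk H]]] := below_trans brs bpq (parent_neq i0 iN par).
by case: H => [[-> [? _]]|[-> [? _]]]; apply: stage_edge => //; lia.
Qed.

Lemma parent_root i N d p q r s : (0 < i)%N -> (i < N)%N -> parent i N d p q r s ->
  ed p q != ed (hub i) i.
Proof.
move=> i0 iN; have [b0 b2 bi] := hubP i0; rewrite edE.
case=> [[_ -> _ _ /and4P[? ? ? ?]]|[_ -> _ _ /and4P[? ? ? ?]]|
  [_ _ _ /and3P[? ? ?] /and4P[? ? ? ?]]|[_ -> _ _ /andP[? ?]]]; lia.
Qed.

Lemma parent_fun i N d p q r s d' p' q' r' s' : (0 < i)%N -> (i < N)%N ->
  parent i N d p q r s -> parent i N d' p' q' r' s' -> ed p' q' = ed p q ->
  d' = d /\ ed r' s' = ed r s.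
Proof.
move=> i0 iN; have [b0 b2 bi] := hubP i0; move=> h h' E.
suff [-> -> ->] : [/\ d' = d, r' = r & s' = s] by [].
case: h' E => [[-> -> -> -> /and4P[? ? ? ?]]|[-> -> -> -> /and4P[? ? ? ?]]|
  [-> -> -> /and3P[? ? ?] /and4P[? ? ? ?]]|[-> -> -> -> /andP[? ?]]];
case: h => [[-> -> -> -> /and4P[? ? ? ?]]|[-> -> -> -> /and4P[? ? ? ?]]|
  [-> -> -> /and3P[? ? ?] /and4P[? ? ? ?]]|[-> -> -> -> /andP[? ?]]];
  move=> /edP[] [? ?]; split; lia.
Qed.

(** Depth decreases towards the root: besides its own free face, the triangle over a tree edge
    contains at most that of the parent, which has lower rank. *)
Lemma parent_lt i N d p q r s d' p' q' r' s' : (0 < i)%N -> (i < N)%N ->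
  parent i N d p q r s -> parent i N d' p' q' r' s' -> ed p' q' = ed r s -> (d' < d)%N.
Proof.
move=> i0 iN; have [b0 b2 bi] := hubP i0.
case=> [[-> _ -> -> /and4P[? ? ? ?]]|[-> _ -> -> /and4P[? ? ? ?]]|
  [-> -> -> /and3P[? ? ?] /and4P[? ? ? ?]]|[-> _ -> -> /andP[? ?]]];
case=> [[-> -> _ _ /and4P[? ? ? ?]]|[-> -> _ _ /and4P[? ? ? ?]]|
  [-> _ _ /and3P[? ? ?] /and4P[? ? ? ?]]|[-> -> _ _ /andP[? ?]]];
  move=> /edP[] [? ?]; lia.
Qed.

(** The leading vertex of [sg'] either precedes [ed i N], and then all its ranks are lower, or it is
    [ed i N], and both faces come from the same tree. *)
Lemma tree_face_new k sg a k' sg' a' : tree_face k sg a -> tree_face k' sg' a' ->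
  (sg' `<=` a |` sg)%fset -> (k' < k)%N \/ [/\ k' = k, sg' = sg & a' = a].
Proof.
move=> [i [N [i0 iN N2 H]]] [i' [N' [i0' iN' N2' H']]] /fsubsetP sub.
have [b0 b2 bi] := hubP i0.
have rk : (rank i N <= k)%N by case: H => [[-> _ _]|[d [p [q [r [s [_ -> _ _]]]]]]]; lia.
have rk' : (k' <= rank i' N' + 3)%N.
  case: H' => [[-> _ _]|[d [p [q [r [s [par -> _ _]]]]]]]; first by lia.
  by have := parent_le3 par; lia.
have x'sg' : ed i' N' \in sg'.
  by case: H' => [[_ -> _]|[d [p [q [r [s [_ _ -> _]]]]]]]; rewrite !inE eqxx.
have : ed i' N' = ed i N \/ below i N (ed i' N').
  have := sub _ x'sg'; case: H => [[_ -> ->]|[d [p [q [r [s [par _ -> ->]]]]]]].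
    rewrite !inE => /orP[/eqP ->|/eqP ->]; last by left.
    by right; apply: belowN; lia.
  have [bpq brs] := parent_below i0 iN N2 par.
  by rewrite !inE => /or3P[] /eqP ->; [right|left|right].
case=> [/edP[[Ei EN]|[? ?]]|[p [q [p0 pq h E]]]]; last first.
- have [? ?] : i' = p /\ N' = q by move/edP: E => [] [? ?]; lia.
  by left; have := rank_below pq h; subst; lia.
- by exfalso; lia.
rewrite {}Ei {}EN in H' *.
case: H' => [[k'E sg'E a'E]|[d' [p' [q' [r' [s' [par' k'E sg'E a'E]]]]]]].
  case: H => [[kE sgE aE]|[d [p [q [r [s [par kE _ _]]]]]]].
    by right; rewrite kE sgE aE.
  by left; rewrite kE k'E; have := parent_le3 par; lia.
have v'sg' : ed p' q' \in sg' by rewrite sg'E !inE eqxx orbT.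
have [bpq' _] := parent_below i0 iN N2 par'.
have := sub _ v'sg'; case: H => [[kE sgE aE]|[d [p [q [r [s [par kE sgE aE]]]]]]].
  by rewrite sgE aE !inE (negbTE (parent_root i0 iN par')) (negbTE (below_neq iN bpq')).
rewrite sgE aE !inE (negbTE (below_neq iN bpq')) /= => /orP[] /eqP E.
  by left; rewrite kE k'E; have := parent_lt i0 iN par par' E; lia.
have [dd E'] := parent_fun i0 iN par par' E.
by right; rewrite kE k'E sg'E a'E dd E E'.
Qed.

Lemma tree_face_finite k :
  finite_set [set p : {fset {fset nat}} * {fset nat} | tree_face k p.1 p.2].
Proof.
pose A := fpowerset (vertices k).
apply: (@sub_finite_set _ _ ([set` fpowerset A] `*` [set` A])); last first.
  by apply: finite_setX; exact: finite_fset.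
have sub i N e : (i < N)%N -> (rank i N <= k)%N -> e = ed i N \/ below i N e ->
    (0 < i)%N -> e \in A.
  (* The rank is at least 4 N^2, so [k] bounds [N] and with it all labels involved. *)
  move=> iN rk h i0; have Nk : (N <= k)%N by move: rk; rewrite /rank; nia.
  rewrite /A fpowersetE; apply/fsubsetP => v; case: h => [->|[p [q [p0 pq h ->]]]];
    by rewrite mem_vertices !inE => /orP[] /eqP ->; lia.
move=> [sg a] /= [i [N [i0 iN N2 [[kE -> ->]|[d [p [q [r [s [par kE -> ->]]]]]]]]]].
  have [b0 b2 bi] := hubP i0; split => /=; last first.
    by apply: (sub i N) => //; [lia|right; apply: belowN; lia].
  rewrite fpowersetE; apply/fsubsetP => e; rewrite inE => /eqP ->.
  by apply: (sub i N) => //; [lia|left].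
have [bpq brs] := parent_below i0 iN N2 par; split => /=; last first.
  by apply: (sub i N) => //; [lia|right].
rewrite fpowersetE; apply/fsubsetP => e; rewrite !inE => /orP[] /eqP ->.
  by apply: (sub i N) => //; [lia|left].
by apply: (sub i N) => //; [lia|right].
Qed.

Lemma tree_expansions : expansions squareless (ed 1 2) tree_face.
Proof.
split.
- apply: squareless_small.
  + by apply/fset0Pn; exists (ed 1 2); rewrite inE.
  + by move=> e; rewrite inE => /eqP ->; exists 1%N, 2%N.
  + by rewrite cardfs1.
- exact: tree_face_finite.
- exact: tree_face_simplex.
- exact: tree_face_face.
- exact: tree_face_new.
move=> k sg a [i [N [i0 iN N2 H]]].
have x : ed i N \in sg by case: H => [[_ -> _]|[d [p [q [r [s [_ _ -> _]]]]]]]; rewrite !inE eqxx.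
by apply: contraTneq x => ->; rewrite inE edE; lia.
Qed.

(** * The triangles outside the contractible subcomplex *)

Definition critical : set {fset {fset nat}} :=
  [set s | simplices squareless s /\ forall k, ~ tree_stage k s].

(** All vertices and edges lie in the stages, and no simplex with more than three vertices survives
    the collapse. *)
Lemma critical_card s : critical s -> #|` s| = 3%N.
Proof.
move=> [[Ks sM] nst]; have [es fs] := D2_star_free Ks.
have s0 := simplices_neq0 Ks.
have le3 : (#|` s| <= 3)%N.
  rewrite leqNgt; apply/negP => /(square_face_card Ks)[sg [a [Ma sub]]].
  by move: (sM _ _ Ma); rewrite sub.
have [e ess] := fset0Pn _ s0.
have ne1 : #|` s| <> 1%N.
  move=> s1; have [i [N [i0 iN E]]] := es e ess.
  apply: (nst (rank i N).+1); suff -> : s = [fset ed i N]%fset by exact: stage_vertex.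
  by apply/esym/eqP; rewrite eqEfcard cardfs1 s1 andbT -E fsub1set.
have ne2 : #|` s| <> 2%N.
  move=> /cardfs2_ex[f [g [fg E]]].
  have [i [N [i0 iN Ef]]] : exists i j, [/\ (0 < i)%N, (i < j)%N & f = ed i j].
    by apply: es; rewrite E !inE eqxx.
  have [p [q [p0 pq Eg]]] : exists i j, [/\ (0 < i)%N, (i < j)%N & g = ed i j].
    by apply: es; rewrite E !inE eqxx orbT.
  have [h|h] := boolP ((q < N) || ((q == N) && (p < i)))%N.
    apply: (nst (rank i N + 4)%N); rewrite E Ef; apply: stage_edge => //; last by lia.
    by exists p, q.
  apply: (nst (rank p q + 4)%N); rewrite E Eg fsetUC; apply: stage_edge => //; last by lia.
  exists i, N; split => //.
  have : ~~ ((i == p) && (N == q)).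
    by apply: contraNN fg => /andP[/eqP h1 /eqP h2]; rewrite Ef Eg h1 h2.
  by lia.
move: s0 le3 ne1 ne2; rewrite -cardfs_gt0; case: #|` s| => [|[|[|[|n]]]] //.
Qed.

(** With its largest label n + 6 at an end, the path is not a collapsed face. Nor does it lie over a
    tree edge: for [i = 3] the parent of {4, 5} is {3, 4}, through the smaller endpoint, and not {3,
    5}. *)
Definition critical_path (n : nat) : {fset {fset nat}} :=
  [fset ed (n + 6) 3; ed 3 5; ed 5 4]%fset.

Lemma critical_pathP n : critical (critical_path n).
Proof.
have c3 : #|` critical_path n| = 3%N by rewrite card_triangle // edE; lia.
split; first split.
- have u : uniq [:: n + 6; 3; 5; 4]%N by rewrite /= !inE; lia.
  have n0 : (0 < n + 6)%N by lia.
  apply: (simplices_sub (square_D2 u n0 _ _ _)) => //.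
    by apply/fsubsetP => e; rewrite !inE -orbA => /or3P[] ->; rewrite ?orbT.
  by rewrite -cardfs_gt0 c3.
- move=> sg a Ma; apply/negP => sub.
  have E : sg = critical_path n by apply/eqP; rewrite eqEfcard sub (square_face_card3 Ma) c3.
  have [k [i [N [j [h ki kj Esg _]]]]] := Ma.
  have h1 : ed i N \in critical_path n by rewrite -E Esg !inE eqxx orbT.
  have h2 : ed N j \in critical_path n by rewrite -E Esg !inE eqxx orbT.
  have h3 : ed k i \in critical_path n by rewrite -E Esg !inE eqxx.
  move: h1 h2 h3 h; rewrite !inE -!orbA => /or3P[] /eqP/edP[] [-> ->]
    /or3P[] /eqP/edP[] [? ?] /or3P[] /eqP/edP[] [? ?] ?; lia.
move=> k [E|[l [sg [a [_ Ma H]]]]]; first by move: c3; rewrite E cardfs1.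
have [i [N [i0 iN N2 H']]] := Ma.
case: H' => [[_ Esg Ea]|[d [p [q [r [s [par _ Esg Ea]]]]]]].
  have : (#|` critical_path n| <= 2)%N.
    by case: H => ->; rewrite Esg ?Ea ?cardfs1 ?cardfs2; [|case: (_ != _)].
  by rewrite c3.
have {H} E : critical_path n = [fset ed r s; ed i N; ed p q]%fset.
  case: H => H; last by rewrite H Esg Ea fsetUA.
  have : (#|` critical_path n| <= 2)%N by rewrite H Esg cardfs2; case: (_ != _).
  by rewrite c3.
have [bpq brs] := parent_below i0 iN N2 par.
have h1 : ed i N \in critical_path n by rewrite E !inE eqxx orbT.
have h2 : ed p q \in critical_path n by rewrite E !inE eqxx orbT.
have h3 : ed r s \in critical_path n by rewrite E !inE eqxx.
have h4 : ed (n + 6) 3 \in [fset ed r s; ed i N; ed p q]%fset by rewrite -E !inE eqxx.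
have [ei eN] : i = 3%N /\ N = (n + 6)%N.
  have : (n + 6 <= N)%N.
    move: h4; rewrite !inE -orbA => /or3P[] /eqP F.
    - by have := @below_label i N 3%N (n + 6)%N; rewrite edC F; apply => //; lia.
    - by move/edP: F => [] [? ?]; lia.
    - by have := @below_label i N 3%N (n + 6)%N; rewrite edC F; apply => //; lia.
  by move: h1; rewrite !inE -orbA => /or3P[] /eqP/edP[] [? ?]; lia.
subst i N; have hub3 : hub 3%N = 1%N by [].
move: h2 h3; rewrite !inE -!orbA.
case: par => [[_ -> -> -> /and4P[? ? ? ?]]|[_ -> -> -> /and4P[? ? ? ?]]|
  [_ -> -> /and3P[? ? ?] /and4P[? ? ? ?]]|[_ -> -> -> /andP[? ?]]];
  move=> /or3P[] /eqP/edP[] [? ?] /or3P[] /eqP/edP[] [? ?]; lia.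
Qed.

Lemma critical_path_inj : injective critical_path.
Proof.
move=> m n /fsetP E; have := E (ed (m + 6) 3); rewrite !inE eqxx /= !edE; lia.
Qed.

Lemma critical_enum : exists e : nat -> {fset {fset nat}}, injective e /\
  forall s, (exists n, s = e n) <-> critical s.
Proof.
have inf : infinite_set critical.
  move=> fin; apply: infinite_nat.
  have -> : [set: nat] = critical_path @^-1` critical.
    by apply/seteqP; split => // n _; exact: critical_pathP.
  by apply: finite_preimage fin => m n _ _; exact: critical_path_inj.
have /card_set_bijP[f [_ finj fsurj]] := eq_card_nat (countableP critical) inf.
have [e he] : exists e : nat -> {fset {fset nat}}, forall n, critical (e n) /\ f (e n) = n.
  suff h : forall n, exists s, critical s /\ f s = n.
    by have [e he] := choice h; exists e.
  by move=> n; have [s cs <-] := fsurj n I; exists s.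
exists e; split; first by move=> m n E; rewrite -(he m).2 E (he n).2.
move=> s; split; first by move=> [n ->]; exact: (he n).1.
move=> cs; exists (f s); apply: finj; rewrite ?inE //; first exact: (he _).1.
by rewrite (he _).2.
Qed.

Theorem theorem1p2 (R : realType) :
  homotopy_equivalent R (realization R D2) (countable_sphere_wedge R 2).
Proof.
apply: strong_equivalentW.
apply: (@strong_equivalent_trans _ _ (realization R squareless)).
  apply: collapse_equivalent.
  - exact: square_face_simplex.
  - exact: square_face_free.
  - exact: square_face_uniq.
have [e [einj ecrit]] := critical_enum.
apply: (bouquet_equivalent R tree_expansions (e := e)) => //.
by move=> n; apply: critical_card; apply/ecrit; exists n.
Qed.
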